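(* Let $n\ge 2$ be an integer, let $\delta\in(0,\infty)$ be an unknown parameter, and let $X_1,X_2,\ldots$ be i.i.d. exponential random variables with density $f(x;\delta)=\frac1\delta e^{-x/\delta}$, $x\ge 0$. Let $X_{T(1)}$ and $X_{T(n)}$ be the first and $n$-th upper record values of the sequence and let $R_n=X_{T(n)}-X_{T(1)}$ be the upper record range. Consider estimation of $\delta$ on the basis of the observation $R_n$ under the squared error loss $$L(\hat\delta,\delta)=(\hat\delta-\delta)^2 .$$ Then the estimator $m\,(X_{T(n)}-X_{T(1)})+d=mR_n+d$ is admissible in each of the following cases: 1. $m\in[0,1/n)$ and $d>0$; 2. $m=1/n$ and $d>0$.
   Context: Upper record times and values: $T(1)=1$ and $T(k+1)=\min\{j>T(k): X_j\ge X_{T(k)}\}$ for $k\ge1$; the upper record values are $X_{T(1)},X_{T(2)},\ldots$. For the exponential distribution with scale $\delta$, the upper record range $R_n=X_{T(n)}-X_{T(1)}$ has density $$f_{R_n}(r)=\frac{r^{n-2}e^{-r/\delta}}{(n-2)!\,\delta^{n-1}},\qquad r>0,$$ i.e. $R_n$ has the Gamma distribution with shape $n-1$ and scale $\delta$. An estimator based on $R_n$ is a (Borel measurable, real-valued) function $\hat\delta=\hat\delta(R_n)$; its risk at $\delta$ is $\mathrm{Risk}(\hat\delta,\delta)=E_\delta[L(\hat\delta(R_n),\delta)]\in[0,\infty]$. An estimator $\hat\delta$ based on $R_n$ is admissible if there is no estimator $\hat\delta'$ based on $R_n$ with $\mathrm{Risk}(\hat\delta',\delta)\le \mathrm{Risk}(\hat\delta,\delta)$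 for all $\delta\in(0,\infty)$ and with strict inequality for at least one $\delta\in(0,\infty)$. *)

(* Defs.v *)
From HB Require Import structures.
From mathcomp Require Import all_boot all_order all_algebra.
From mathcomp Require Import all_classical all_reals all_analysis.
Import Order.TTheory GRing.Theory Num.Theory.
Import numFieldNormedType.Exports.

Set Implicit Arguments.
Unset Strict Implicit.
Unset Printing Implicit Defensive.

Local Open Scope classical_set_scope.
Local Open Scope ring_scope.

(* Sequences are indexed from 0: the observation X_i of the sequence
   X_1, X_2, ... is [X i.-1]. *)

Section Records.
Context {R : realType}.

(* The minimum of [set j | p j], [None] when that set is empty. *)
Definition least_index (p : pred nat) : option nat :=
  if pselect (exists j, p j) is left exp then Some (ex_minn exp) else None.

(* [record_time x k] is the (0-based) index at which the (k+1)-st upper record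
   of x occurs, i.e. T(k+1) - 1; [None] means that there is no such record. *)
Fixpoint record_time (x : nat -> R) (k : nat) : option nat :=
  if k is k'.+1 then
    if record_time x k' is Some t
    then least_index (fun j => (t < j)%N && (x t <= x j))
    else None
  else Some 0%N.

(* R_n = X_{T(n)} - X_{T(1)} for n >= 1.  For i.i.d. exponential observations
   T(n) is almost surely finite, so the value 0 given to R_n when T(n) does not
   exist is immaterial. *)
Definition record_range (x : nat -> R) (n : nat) : R :=
  match record_time x 0, record_time x n.-1 with
  | Some t1, Some tn => x tn - x t1
  | _, _ => 0
  end.

End Records.

Section Sampling.
Context {d : measure_display} {T : measurableType d} {R : realType}.

Definition mutually_independent (P : probability T R)
    (X : nat -> {mfun T >-> R}) : Prop :=
  forall (J : seq nat) (A : nat -> set R),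
    uniq J -> (forall i, measurable (A i)) ->
    P (\bigcap_(i in [set` J]) (X i @^-1` A i))
    = (\prod_(i <- J) P (X i @^-1` A i))%E.

(* The library parametrizes the exponential law by its rate, which is the
   inverse of the scale delta. *)
Definition exponential_scale (P : probability T R) (X : {mfun T >-> R})
    (delta : R) : Prop :=
  forall A : set R, measurable A ->
    distribution P X A = exponential_prob delta^-1 A.

Definition iid_exponential (P : probability T R) (X : nat -> {mfun T >-> R})
    (delta : R) : Prop :=
  mutually_independent P X /\ forall i, exponential_scale P (X i) delta.

End Sampling.

Section Decision.
Context {d : measure_display} {T : measurableType d} {R : realType}.

Definition squared_error (a delta : R) : R := (a - delta) ^+ 2.

(* The parameter space is the set of delta > 0; the members [P delta] of the
   family of sampling laws with delta <= 0 play no role below. *)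
Variables (P : R -> probability T R) (L : R -> R -> R) (Y : T -> R).

Definition risk (est : R -> R) (delta : R) : \bar R :=
  'E_(P delta)[fun w => L (est (Y w)) delta]%E.

Definition admissible (est : R -> R) : Prop :=
  measurable_fun [set: R] est /\
  ~ exists est' : R -> R,
      [/\ measurable_fun [set: R] est',
          forall delta : R, 0 < delta -> (risk est' delta <= risk est delta)%E
        & exists2 delta : R, 0 < delta & (risk est' delta < risk est delta)%E].

End Decision.

(* Main.v *)
(* Write k = n - 1 and x = 1/delta.  The pair (running maximum, number of
   records) is a Markov chain driven by independent innovations, and lack of
   memory makes each record increment a fresh exponential variable.  Hence
   E_delta[phi(R_n)] = x^k E_1[exp((1 - x) R_n) phi(R_n)]: the laws of R_n form
   an exponential family, and only this, not the Gamma density, is needed.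

   For 0 < m <= 1/n we follow Karlin.  Let g be the difference between a
   competitor and m R_n + d, and integrate g against the integrating factor
   x^(1/m) exp(- x d/m) exp((1 - x) R_n) to get psi(x).  Dominance and
   Cauchy-Schwarz yield psi' >= a psi^2 with
   a(x) = x^(k - 1/m) exp(x d/m) / (2 m), whose integral diverges at +oo, and
   also at 0 precisely because 1/m >= k + 1.  So psi = 0 and then g = 0 almost
   surely.  For m = 0 the risk vanishes at delta = d, which forces a competitor
   to be almost surely constant. *)

Require Import Defs.
From HB Require Import structures.
From mathcomp Require Import all_boot all_order all_algebra.
From mathcomp Require Import all_classical all_reals all_analysis.
From mathcomp Require Import measurable_realfun ring lra.
Import Order.TTheory GRing.Theory Num.Theory.
Import numFieldNormedType.Exports.
Local Open Scope classical_set_scope.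
Local Open Scope ring_scope.

Set Implicit Arguments.
Unset Strict Implicit.
Unset Printing Implicit Defensive.

(** * Records as a Markov chain *)

(* State: (x_0, (current record value, number of records after x_0)). *)
Fixpoint record_chain {R : realType} (x : nat -> R) (t : nat) :
    R * (R * nat) :=
  if t is t'.+1 then
    let s := record_chain x t' in
    if s.2.1 <= x t then (s.1, (x t, s.2.2.+1)) else s
  else (x 0, (x 0, 0))%N.

Section record_chain_theory.
Context {R : realType}.
Implicit Types (x : nat -> R) (k t : nat).

Lemma least_indexP (p : pred nat) t :
  least_index p = Some t <-> p t /\ forall j, p j -> (t <= j)%N.
Proof.
rewrite /least_index; case: pselect => [exp|nexp]; last first.
  by split=> // -[pt _]; exfalso; apply: nexp; exists t.
case: ex_minnP => u pu min_u; split=> [[<-]//|[pt min_t]].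
by congr Some; apply/eqP; rewrite eqn_leq min_u// min_t.
Qed.

Lemma record_chain1 x t : (record_chain x t).1 = x 0%N.
Proof. by elim: t => //= t IH; case: ifP. Qed.

(** The invariant of the chain: [u] is the time of the latest record up to [t]. The strict bound on
    later observations is what identifies the next observation reaching [x u] as the least one,
    hence as the next record. *)
Lemma record_chain_last x t : exists2 u, (u <= t)%N &
  [/\ record_time x (record_chain x t).2.2 = Some u,
      x u = (record_chain x t).2.1 &
      forall j, (u < j <= t)%N -> x j < x u].
Proof.
elim: t => [|t [u ut [rec_u xu last_u]]].
  by exists 0%N => //; split => // j; case: j.
rewrite [record_chain x t.+1]/=; case: ifPn => [le_M|].
  exists t.+1 => //; split => //=; last by case=> // j /andP[/leq_trans/[apply]]; rewrite ltnn.
  rewrite rec_u; apply/least_indexP; split=> [|j /andP[uj xuj]].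
    by rewrite ltnS ut xu.
  rewrite ltnNge; apply/negP => jt.
  by have := last_u j; rewrite uj jt => /(_ erefl); rewrite ltNge xuj.
rewrite -ltNge => lt_M; exists u; first exact: leqW.
split => // j /andP[uj]; rewrite leq_eqVlt => /predU1P[->|jt].
  by rewrite xu.
by apply: last_u; rewrite uj.
Qed.

Lemma record_chain_stay x u t : (u <= t)%N ->
  (forall j, (u < j <= t)%N -> x j < (record_chain x u).2.1) ->
  record_chain x t = record_chain x u.
Proof.
elim: t => [|t IH]; first by rewrite leqn0 => /eqP->.
rewrite leq_eqVlt => /predU1P[->//|ut] below.
have E : record_chain x t = record_chain x u.
  by apply: IH => // j /andP[uj jt]; apply: below; rewrite uj leqW.
by rewrite /= E ifN// -ltNge below// ut leqnn.
Qed.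

(** Induction on [k]: if [u] is the previous record time, minimality of [t] keeps every observation
    strictly between [u] and [t] below [x u], so the chain is frozen until it jumps at [t]. *)
Lemma record_chain2 x k t :
  record_time x k = Some t -> (record_chain x t).2 = (x t, k).
Proof.
elim: k t => [|k IH] t /=; first by case=> <-.
case: record_time (IH) => // u /(_ _ erefl) Eu /least_indexP[/andP[ut xut] min_t].
case: t ut xut min_t => // t; rewrite ltnS => ut xut min_t.
have E : record_chain x t = record_chain x u.
  apply: record_chain_stay => // j /andP[uj jt].
  rewrite Eu/= ltNge; apply/negP => xuj.
  by have := min_t j; rewrite uj xuj ltnNge jt => /(_ erefl).
by rewrite /= E Eu/= xut.
Qed.

(** Expresses a record at [t.+1] through the state at [t] and the single observation [x t.+1], the
    form to which independence applies. *)
Lemma record_timeS_chain x k t : (record_time x k.+1 == Some t.+1) =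
  ((record_chain x t).2.2 == k) && ((record_chain x t).2.1 <= x t.+1).
Proof.
apply/eqP/andP => [rec_t|[/eqP<- le_M]]; last first.
  have [u ut [rec_u xu last_u]] := record_chain_last x t.
  rewrite /= rec_u; apply/least_indexP; split=> [|j /andP[uj xuj]].
    by rewrite ltnS ut xu.
  rewrite ltnNge; apply/negP => jt.
  by have := last_u j; rewrite uj jt => /(_ erefl); rewrite ltNge xuj.
have := record_chain2 rec_t; move: rec_t => /=.
case: ifPn => [//|].
  by move=> _ _ [->].
move=> nle; case Ek : record_time => [u|//] /least_indexP[/andP[]].
rewrite ltnS => ut xut min_t Et.
have E : record_chain x t = record_chain x u.
  apply: record_chain_stay => // j /andP[uj jt].
  rewrite (record_chain2 Ek)/= ltNge; apply/negP => xuj.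
  by have := min_t j; rewrite uj xuj ltnNge jt => /(_ erefl).
by move: nle; rewrite E (record_chain2 Ek)/= xut.
Qed.

Lemma record_range_ge0 x n : 0 <= record_range x n.
Proof.
rewrite /record_range /=; case E : record_time => [t|//].
suff le0 k u : record_time x k = Some u -> x 0%N <= x u by rewrite subr_ge0 (le0 _ _ E).
elim: k u {E} => [|k IH] u /=; first by case=> <-.
case: record_time (IH) => // s /(_ _ erefl) xs /least_indexP[/andP[_ xsu] _].
exact: le_trans xs xsu.
Qed.

End record_chain_theory.

(** * Independence of a recursive state from future observations *)

Section state_independence.
Context {d d'} {T : measurableType d} {S : measurableType d'} {R : realType}.
Variables (P : probability T R) (X : nat -> {mfun T >-> R}).
Variables (state : nat -> T -> S) (init : R -> S) (step : S * R -> S).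
Hypothesis minit : measurable_fun [set: R] init.
Hypothesis mstep : measurable_fun [set: S * R] step.
Hypothesis state0 : forall w, state 0%N w = init (X 0%N w).
Hypothesis stateS : forall t w, state t.+1 w = step (state t w, X t.+1 w).

Lemma measurable_state t : measurable_fun [set: T] (state t).
Proof.
elim: t => [|t IH].
  by rewrite (_ : state 0%N = init \o X 0%N); [exact: measurableT_comp|apply/funext].
rewrite (_ : state t.+1 = step \o (fun w => (state t w, X t.+1 w))); last exact/funext.
by apply: measurableT_comp => //; exact: measurable_fun_pair.
Qed.

HB.instance Definition _ t :=
  isMeasurableFun.Build _ _ _ _ (state t) (measurable_state t).

Local Notation event J A := (\bigcap_(i in [set` J]) (X i @^-1` A i)).

Hypothesis indepX : mutually_independent P X.

Let measurable_event (J : seq nat) (A : nat -> set R) :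
  (forall i, measurable (A i)) -> measurable (event J A).
Proof.
move=> mA; apply: bigcap_measurableType => // i _.
by rewrite -[X in measurable X]setTI; exact: measurable_funPT.
Qed.

(** Overwriting [A] at the fresh index [t] absorbs a condition on [X t] into an event of the same
    product form. *)
Let event_cons (J : seq nat) (A : nat -> set R) t B :
    measurable B -> t \notin J ->
  let A' := fun i => if i == t then B else A i in
  event (t :: J) A' = X t @^-1` B `&` event J A /\
  (\prod_(i <- t :: J) P (X i @^-1` A' i) =
   P (X t @^-1` B) * \prod_(i <- J) P (X i @^-1` A i))%E.
Proof.
move=> mB tJ A'; rewrite /A'; split.
  rewrite (_ : [set` t :: J] = t |` [set` J]) ?bigcap_setU1; last first.
    by apply/seteqP; split=> i /=; rewrite inE => /predU1P.
  rewrite eqxx; congr (_ `&` _).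
  apply: eq_bigcapr => i /= iJ; case: eqP => // it.
  by rewrite -it iJ in tJ.
rewrite big_cons eqxx; congr (_ * _)%E; apply: eq_big_seq => i iJ.
by case: eqP => // it; rewrite -it iJ in tJ.
Qed.

(** All finite families of later observations are included, not only the next one, so that the
    property can be carried from [t] to [t.+1]. *)
Let independent_of_future t := forall (C : set S) (J : seq nat) (A : nat -> set R),
  measurable C -> uniq J -> (forall i, measurable (A i)) ->
  (forall i, i \in J -> (t < i)%N) ->
  (P (state t @^-1` C `&` event J A) =
   P (state t @^-1` C) * \prod_(i <- J) P (X i @^-1` A i))%E.

Let state_next t w := (state t w, X t.+1 w).

Let measurable_state_next t : measurable_fun [set: T] (state_next t).
Proof. by apply: measurable_fun_pair => //; exact: measurable_state. Qed.

HB.instance Definition _ t :=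
  isMeasurableFun.Build _ _ _ _ (state_next t) (measurable_state_next t).

(** For a fixed future event both sides are finite measures of [Z], so rectangles suffice: they form
    a generating pi-system. On a rectangle the condition on [X t.+1] joins the future event and the
    assumption at [t] applies. *)
Let state_next_independent t : independent_of_future t ->
  forall Z (J : seq nat) (A : nat -> set R),
  measurable Z -> uniq J -> (forall i, measurable (A i)) ->
  (forall i, i \in J -> (t.+1 < i)%N) ->
  (P (state_next t @^-1` Z `&` event J A) =
   (distribution P (state t) \x distribution P (X t.+1))%E Z *
   \prod_(i <- J) P (X i @^-1` A i))%E.
Proof.
move=> IH Z J A mZ uJ mA tJ.
have tJ' i : i \in J -> (t < i)%N by move=> /tJ; exact: ltnW.
have tnJ : t.+1 \notin J by apply/negP => /tJ; rewrite ltnn.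
have mD := measurable_event J mA.
set c := \big[*%E/1%E]_(i <- J) _.
(* Recognising [c] as a probability makes it finite and nonnegative, as needed to scale a measure by
   it. *)
have cE : c = P (event J A) by rewrite indepX.
have c_ge0 : (0 <= fine c)%R by rewrite fine_ge0// cE.
have cfin : (fine c)%:E = c by rewrite fineK// cE fin_num_measure.
pose m1 := pushforward (mrestr P mD) (state_next t).
pose m2 := mscale (NngNum c_ge0) (distribution P (state t) \x distribution P (X t.+1))%E.
suff : m1 Z = m2 Z.
  by rewrite /m1 /m2 /pushforward /mrestr /mscale/= cfin muleC => <-.
apply: (measure_unique [set B `*` C | B in measurable & C in measurable]
   (fun=> setT)) => //.
- by rewrite measurable_prod_measurableType.
- move=> _ _ [B1 mB1 [C1 mC1 <-]] [B2 mB2 [C2 mC2 <-]].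
  by rewrite -setXI; exists (B1 `&` B2); [exact: measurableI|]; exists (C1 `&` C2); [exact: measurableI|].
- by move=> _; exists setT => //; exists setT => //; rewrite setXTT.
- by rewrite bigcup_const.
- move=> _ [B mB [B' mB' <-]].
  have [E1 E2] := event_cons A mB' tnJ.
  rewrite [RHS](_ : _ = c * (P (state t @^-1` B) * P (X t.+1 @^-1` B')))%E; last first.
    by rewrite -[X in (X * _)%E]cfin; congr (_ * _)%E; exact: product_measure1E.
  transitivity (P (state t @^-1` B `&`
      event (t.+1 :: J) (fun i => if i == t.+1 then B' else A i))).
    by rewrite E1 setIA.
  rewrite IH//=.
  + by rewrite E2 -/c muleA muleC.
  + by rewrite tnJ.
  + by move=> i; case: ifP.
  + by move=> i; rewrite inE => /predU1P[->|/tJ'].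
- move=> _; rewrite /m1 /pushforward/= /mrestr/=.
  rewrite (le_lt_trans (probability_le1 _ _)) ?ltry//; apply: measurableI => //.
  by rewrite -[X in measurable X]setTI; exact: measurable_funPT.
Qed.

(** The initial state is a function of [X 0], and each later state is a function of the previous
    state and one new observation; preimages reduce both cases to product events. *)
Lemma state_independent t : independent_of_future t.
Proof.
elim: t => [|t IH] C J A mC uJ mA tJ.
  have mB : measurable (init @^-1` C) by rewrite -[X in measurable X]setTI; exact: minit.
  have zJ : 0%N \notin J by apply/negP => /tJ.
  have [E1 E2] := event_cons A mB zJ.
  rewrite (_ : state 0%N @^-1` C = X 0%N @^-1` (init @^-1` C)); last first.
    by apply/funext => w /=; rewrite /preimage/= state0.
  rewrite -E1 indepX ?E2//=; first by rewrite zJ.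
  by move=> i; case: ifP.
have mC' : measurable (step @^-1` C) by rewrite -[X in measurable X]setTI; exact: mstep.
have stE : state t.+1 @^-1` C = state_next t @^-1` (step @^-1` C).
  by apply/funext => w; rewrite /preimage/= stateS.
rewrite stE (state_next_independent IH)//; congr (_ * _)%E.
have := @state_next_independent t IH _ [::] A mC' isT mA.
by rewrite big_nil mule1 set_nil bigcap_set0 setIT => ->.
Qed.

(** With an empty future event, the joint law of the state and the next observation is a product
    measure; Tonelli then integrates the innovation out first. *)
Lemma integral_state_next (t : nat) (H : S * R -> \bar R) :
  measurable_fun [set: S * R] H -> (forall z, 0 <= H z)%E ->
  (\int[P]_w H (state t w, X t.+1 w) =
   \int[P]_w \int[distribution P (X t.+1)]_y H (state t w, y))%E.
Proof.
move=> mH H0.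
have -> : (\int[P]_w H (state t w, X t.+1 w) =
    \int[distribution P (state_next t)]_z H z)%E.
  by rewrite ge0_integral_distribution.
rewrite (eq_measure_integral (distribution P (state t) \x distribution P (X t.+1))%E); last first.
  move=> Z mZ _.
  have := @state_next_independent t (@state_independent t) Z [::] (fun=> setT) mZ isT (fun=> measurableT).
  by rewrite big_nil mule1 set_nil bigcap_set0 setIT; apply.
rewrite fubini_tonelli1// ge0_integral_distribution//.
- exact: measurable_fun_fubini_tonelli_F.
- by move=> s; apply: integral_ge0.
Qed.

End state_independence.

(** * The law of successive records *)

Section record_law.
Context {d} {T : measurableType d} {R : realType}.
Variables (P : probability T R) (X : nat -> {mfun T >-> R}) (mu : probability R R).
Hypothesis indepX : mutually_independent P X.
Hypothesis lawX : forall i A, measurable A -> distribution P (X i) A = mu A.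
Hypothesis tail_neq0 : forall y, mu `[y, +oo[%classic != 0%E.

Implicit Types F G : R * R -> \bar R.

Let state_init (x : R) : R * (R * nat) := (x, (x, 0%N)).
Let state_step (z : R * (R * nat) * R) : R * (R * nat) :=
  if z.1.2.1 <= z.2 then (z.1.1, (z.2, z.1.2.2.+1)) else z.1.
Let state t w := record_chain (fun i => X i w) t.

Let measurable_init : measurable_fun [set: R] state_init.
Proof. by apply: measurable_fun_pair => //; exact: measurable_fun_pair. Qed.

Let mx0 : measurable_fun [set: R * (R * nat) * R] (fun z => z.1.1).
Proof. exact: (measurableT_comp measurable_fst measurable_fst). Qed.

Let mM : measurable_fun [set: R * (R * nat) * R] (fun z => z.1.2.1).
Proof.
exact: (measurableT_comp measurable_fst (measurableT_comp measurable_snd measurable_fst)).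
Qed.

Let mK : measurable_fun [set: R * (R * nat) * R] (fun z => z.1.2.2).
Proof.
exact: (measurableT_comp measurable_snd (measurableT_comp measurable_snd measurable_fst)).
Qed.

Let measurable_step : measurable_fun [set: R * (R * nat) * R] state_step.
Proof.
apply: measurable_fun_ifT; first exact: measurable_fun_ler.
- apply: measurable_fun_pair => //; apply: measurable_fun_pair => //.
  exact: (@measurableT_comp _ _ _ _ _ _ S).
- exact: measurable_fst.
Qed.

Let state0 w : state 0 w = state_init (X 0%N w). Proof. by []. Qed.
Let stateS t w : state t.+1 w = state_step (state t w, X t.+1 w). Proof. by []. Qed.

Let state1 t w : (state t w).1 = X 0%N w. Proof. exact: record_chain1. Qed.

Let mstate t : measurable_fun [set: T] (state t).
Proof. exact: (measurable_state measurable_init measurable_step state0 stateS). Qed.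

Lemma integral_record_next t (H : R * (R * nat) * R -> \bar R) :
  measurable_fun [set: R * (R * nat) * R] H -> (forall z, 0 <= H z)%E ->
  (\int[P]_w H (state t w, X t.+1 w) =
   \int[P]_w \int[mu]_y H (state t w, y))%E.
Proof.
move=> mH H0.
rewrite (integral_state_next measurable_init measurable_step state0 stateS)//.
by apply: eq_integral => w _; apply: eq_measure_integral => A mA _; exact: lawX.
Qed.

Definition record_tail (y : R) : R := fine (mu `[y, +oo[%classic).

Lemma record_tailE y : (record_tail y)%:E = mu `[y, +oo[%classic.
Proof. by rewrite fineK// fin_num_measure. Qed.

Lemma record_tail_gt0 y : 0 < record_tail y.
Proof. by rewrite -lte_fin record_tailE lt_neqAle eq_sym tail_neq0 measure_ge0. Qed.

Lemma record_tail_le1 y : record_tail y <= 1.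
Proof. by rewrite -lee_fin record_tailE probability_le1. Qed.

Lemma record_tail_compl_ge0 y : 0 <= 1 - record_tail y.
Proof. by rewrite subr_ge0 record_tail_le1. Qed.

(** Here [z] is the pair of the first observation and the current record. This is the unnormalised
    transition of the chain when the next observation sets a record. *)
Definition above F (z : R * R) : \bar R :=
  (\int[mu]_y (if (z.2 <= y)%R then F (z.1, y) else 0))%E.

Lemma above_ge0 F : (forall z, 0 <= F z)%E -> forall z, (0 <= above F z)%E.
Proof. by move=> F0 z; apply: integral_ge0 => y _; case: ifP. Qed.

Lemma measurable_above F : (forall z, 0 <= F z)%E ->
  measurable_fun [set: R * R] F -> measurable_fun [set: R * R] (above F).
Proof.
move=> F0 mF.
pose f (u : R * R * R) := if u.1.2 <= u.2 then F (u.1.1, u.2) else 0%E.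
apply: (@measurable_fun_fubini_tonelli_F _ _ _ _ _ mu f); last first.
- by move=> u; rewrite /f; case: ifP.
- apply: measurable_fun_ifT => //.
  + apply: measurable_fun_ler => //.
    exact: (measurableT_comp measurable_snd measurable_fst).
  + apply: measurableT_comp => //; apply: measurable_fun_pair => //.
    exact: (measurableT_comp measurable_fst measurable_fst).
Qed.

Lemma above_cst1 z : above (cst 1%E) z = (record_tail z.2)%:E.
Proof.
rewrite /above record_tailE -[in RHS](setIT `[z.2, +oo[%classic) -integral_indic//.
apply: eq_integral => y _; rewrite indicE /=; case: ifPn => zy.
  by rewrite mem_set//= in_itv/= zy.
by rewrite memNset//= in_itv/= (negbTE zy).
Qed.

Lemma measurable_record_tail : measurable_fun [set: R] record_tail.
Proof.
apply/measurable_EFinP.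
rewrite (_ : EFin \o _ = above (cst 1%E) \o (fun y => (0, y))); last first.
  by apply/funext => y; rewrite /= above_cst1.
apply: measurableT_comp; last exact: measurable_fun_pair.
by apply: measurable_above => // z; exact: lee01.
Qed.

(** Record number [k] is the current one at time [t], whenever it was set; in [record_at] below it
    is set exactly at time [t]. *)
Definition occupation t k F : \bar R :=
  (\int[P]_w (if (state t w).2.2 == k then F ((state t w).1, (state t w).2.1) else 0))%E.

Definition record_at t k F : \bar R :=
  (\int[P]_w (if record_time (fun i => X i w) k == Some t
             then F (X 0%N w, X t w) else 0))%E.

Lemma record_at_ge0 t k F : (forall z, 0 <= F z)%E -> (0 <= record_at t k F)%E.
Proof. by move=> F0; apply: integral_ge0 => w _; case: ifP. Qed.

Lemma occupation0 k F : occupation 0 k F = record_at 0 k F.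
Proof.
apply: eq_integral => w _; case: k => [|k] //.
(* At time 0 the chain counts no record after the first, so record [k.+1] cannot occur there. *)
case: (@eqP _ (record_time (fun i => X i w) k.+1) (Some 0%N)) => // E.
by have /= [] := @record_chain2 R (fun i => X i w) k.+1 0%N E.
Qed.

Lemma record_at0 k F : record_at 0 k.+1 F = 0%E.
Proof. by rewrite -occupation0; apply: integral0_eq => w _. Qed.

Lemma record_at_first t F : record_at t.+1 0 F = 0%E.
Proof. by apply: integral0_eq => w _. Qed.

Let measurable_new F k : (forall z, 0 <= F z)%E -> measurable_fun [set: R * R] F ->
  measurable_fun [set: R * (R * nat) * R] (fun z =>
    if (z.1.2.2 == k) && (z.1.2.1 <= z.2) then F (z.1.1, z.2) else 0%E).
Proof.
move=> F0 mF; apply: measurable_fun_ifT => //.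
- by apply: measurable_and; [exact: measurable_fun_eqn|exact: measurable_fun_ler].
- by apply: measurableT_comp => //; exact: measurable_fun_pair.
Qed.

Lemma measurable_record_time k t :
  measurable_fun [set: T] (fun w => record_time (fun i => X i w) k == Some t).
Proof.
case: k t => [|k] [|t].
- exact: (measurable_cst true).
- exact: (measurable_cst false).
- rewrite (_ : (fun w => _) = cst false); first exact: measurable_cst.
  apply/funext => w; apply/negP => /eqP E.
  by have /= [] := @record_chain2 R (fun i => X i w) k.+1 0%N E.
- under eq_fun => w do rewrite record_timeS_chain.
  apply: measurable_and.
    apply: measurable_fun_eqn => //.
    exact: (measurableT_comp measurable_snd (measurableT_comp measurable_snd (mstate t))).
  apply: measurable_fun_ler => //.
  exact: (measurableT_comp measurable_fst (measurableT_comp measurable_snd (mstate t))).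
Qed.

Lemma record_atS t k F : (forall z, 0 <= F z)%E -> measurable_fun [set: R * R] F ->
  record_at t.+1 k.+1 F = occupation t k (above F).
Proof.
move=> F0 mF; rewrite /record_at.
pose H (z : R * (R * nat) * R) :=
  if (z.1.2.2 == k) && (z.1.2.1 <= z.2) then F (z.1.1, z.2) else 0%E.
transitivity (\int[P]_w H (state t w, X t.+1 w))%E.
  by apply: eq_integral => w _; rewrite record_timeS_chain -(state1 t).
rewrite integral_record_next; [|exact: measurable_new|]; last first.
  by move=> z; rewrite /H; case: ifP.
rewrite /H; apply: eq_integral => w _ /=; case: ifP => _ //=.
by apply: integral0_eq.
Qed.

(** The complementary transition: the next observation falls below the current record and the state
    is kept. *)
Definition stay F (z : R * R) : \bar R := ((1 - record_tail z.2)%:E * F z)%E.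

Lemma stay_ge0 F : (forall z, 0 <= F z)%E -> forall z, (0 <= stay F z)%E.
Proof. by move=> F0 z; rewrite mule_ge0// lee_fin record_tail_compl_ge0. Qed.

Lemma measurable_stay F : measurable_fun [set: R * R] F ->
  measurable_fun [set: R * R] (stay F).
Proof.
move=> mF; apply: emeasurable_funM => //; apply/measurable_EFinP.
apply: measurable_funB => //.
exact: (measurableT_comp measurable_record_tail measurable_snd).
Qed.

Lemma measurable_iter_stay F j : measurable_fun [set: R * R] F ->
  measurable_fun [set: R * R] (iter j stay F).
Proof. by move=> mF; elim: j => //= j; exact: measurable_stay. Qed.

Lemma iter_stay_ge0 F j : (forall z, 0 <= F z)%E -> forall z, (0 <= iter j stay F z)%E.
Proof. by move=> F0; elim: j => //= j; exact: stay_ge0. Qed.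

Let mu_below y : mu [set z | ~~ (y <= z)] = (1 - record_tail y)%:E.
Proof.
rewrite (_ : [set _ | _] = ~` `[y, +oo[%classic).
  by rewrite probability_setC// -record_tailE.
by apply/seteqP; split=> z /=; rewrite in_itv/= andbT => /negP.
Qed.

(** Splits on the observation at [t.+1]: either it falls short and record [k] persists ([H]), or it
    is itself record number [k] ([H']). *)
Lemma occupationS t k F : (forall z, 0 <= F z)%E -> measurable_fun [set: R * R] F ->
  occupation t.+1 k F = (occupation t k (stay F) + record_at t.+1 k F)%E.
Proof.
move=> F0 mF.
pose H (z : R * (R * nat) * R) :=
  if (z.1.2.2 == k) && ~~ (z.1.2.1 <= z.2) then F (z.1.1, z.1.2.1) else 0%E.
pose H' (z : R * (R * nat) * R) :=
  if (z.1.2.2.+1 == k) && (z.1.2.1 <= z.2) then F (z.1.1, z.2) else 0%E.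
have H0 z : (0 <= H z)%E by rewrite /H; case: ifP.
have H'0 z : (0 <= H' z)%E by rewrite /H'; case: ifP.
have mH : measurable_fun [set: R * (R * nat) * R] H.
  apply: measurable_fun_ifT => //.
  - apply: measurable_and; first exact: measurable_fun_eqn.
    by apply: measurable_neg; exact: measurable_fun_ler.
  - by apply: measurableT_comp => //; exact: measurable_fun_pair.
have mH' : measurable_fun [set: R * (R * nat) * R] H'.
  apply: measurable_fun_ifT => //.
  - apply: measurable_and; last exact: measurable_fun_ler.
    by apply: measurable_fun_eqn => //; exact: (@measurableT_comp _ _ _ _ _ _ S).
  - by apply: measurableT_comp => //; exact: measurable_fun_pair.
have mpair : measurable_fun [set: T] (fun w => (state t w, X t.+1 w)).
  by apply: measurable_fun_pair => //; exact: mstate.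
transitivity (\int[P]_w (H (state t w, X t.+1 w) + H' (state t w, X t.+1 w)))%E.
  apply: eq_integral => w _; rewrite /H /H' stateS /state_step/=.
  by case: (boolP ((state t w).2.1 <= X t.+1 w)) => _ /=; rewrite ?andbF ?andbT ?add0e ?adde0.
rewrite ge0_integralD//; last 2 first.
- exact: (measurableT_comp mH mpair).
- exact: (measurableT_comp mH' mpair).
congr (_ + _)%E.
  rewrite (integral_record_next t mH)//; apply: eq_integral => w _.
  rewrite /H/=; case: ifP => _ /=; last exact: integral0_eq.
  rewrite /stay/= -mu_below muleC -integral_cst; last first.
    by rewrite (_ : [set _ | _] = ~` `[(state t w).2.1, +oo[%classic);
      [exact: measurableC|apply/seteqP; split=> z /=; rewrite in_itv/= andbT => /negP].
  rewrite [RHS]integral_mkcond; apply: eq_integral => y _.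
  by rewrite patchE; case: ifPn => [h|/negbNE h]; [rewrite mem_set|rewrite memNset//= h].
rewrite /record_at; apply: eq_integral => w _; rewrite /H'/=.
(* For [k = 0] both integrands vanish: a new record has positive number, and record 0 sits at time
   0. *)
case: k {H H0 H'0 mH mH' H'} => [|k] //=.
by rewrite record_timeS_chain eqSS -(state1 t).
Qed.

(** Unrolls [occupationS]: record [k] was set at some time [s] and then survived [t - s]
    observations. *)
Lemma occupationE t k F : (forall z, 0 <= F z)%E -> measurable_fun [set: R * R] F ->
  occupation t k F = (\sum_(s < t.+1) record_at s k (iter (t - s) stay F))%E.
Proof.
elim: t F => [|t IH] F F0 mF; first by rewrite big_ord1 occupation0.
rewrite occupationS// IH; [|exact: stay_ge0|exact: measurable_stay].
rewrite [RHS]big_ord_recr/= subnn; congr (_ + _)%E.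
by apply: eq_bigr => s _; rewrite subSn ?iterSr// -ltnS.
Qed.

(** Summing over the disjoint times at which record [k] may occur gives the mean of [F] at that
    record, restricted to the event that the record exists. *)
Definition record_mean k F : \bar R := (\sum_(t <oo) record_at t k F)%E.

Lemma iter_stay F j z :
  iter j stay F z = (((1 - record_tail z.2) ^+ j)%:E * F z)%E.
Proof.
elim: j => [|j IH]; first by rewrite expr0 mul1e.
by rewrite /= /stay IH muleA -EFinM exprS.
Qed.

(* A record z.2 stands for j more observations with weight (1 - p)^j, where p is
   the tail at z.2, and is then beaten; summing over j gives the law of the
   next record, see [next_recordE]. *)
Definition next_record F (z : R * R) : \bar R :=
  (\sum_(j <oo) iter j stay (above F) z)%E.

Lemma next_record_ge0 F : (forall z, 0 <= F z)%E -> forall z, (0 <= next_record F z)%E.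
Proof.
by move=> F0 z; apply: nneseries_ge0 => j _ _; apply: iter_stay_ge0; exact: above_ge0.
Qed.

Lemma measurable_next_record F : (forall z, 0 <= F z)%E ->
  measurable_fun [set: R * R] F -> measurable_fun [set: R * R] (next_record F).
Proof.
move=> F0 mF; apply: ge0_emeasurable_sum => [j z _ _|j _].
  by apply: iter_stay_ge0; exact: above_ge0.
by apply: measurable_iter_stay; exact: measurable_above.
Qed.

(** The weights form a geometric series of ratio [q < 1], because the tail is positive, with sum the
    inverse of the tail. The next record thus has the law of an observation conditioned to reach the
    current one. *)
Lemma next_recordE F z : (forall z, 0 <= F z)%E ->
  next_record F z = ((record_tail z.2)^-1%:E * above F z)%E.
Proof.
move=> F0; set q := 1 - record_tail z.2.
have q0 : 0 <= q by exact: record_tail_compl_ge0.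
have q1 : `|q| < 1 by rewrite ger0_norm// ltrBlDr ltrDl record_tail_gt0.
have sum_q : (\sum_(j <oo) (q ^+ j)%:E = (record_tail z.2)^-1%:E)%E.
  apply/cvg_lim => //; under eq_fun do rewrite sumEFin.
  apply: cvg_EFin; first exact: nearW.
  have := @cvg_geometric_series R 1 q q1.
  rewrite mul1r subKr.
  apply: cvg_trans; apply: near_eq_cvg; apply: nearW => n /=.
  by rewrite /series/=; apply: eq_bigr => j _; rewrite /geometric/= mul1r.
rewrite /next_record -sum_q -!ge0_integral_count//.
- rewrite -ge0_integralZr//.
  + by apply: eq_integral => j _; rewrite iter_stay.
  + by move=> j _; rewrite lee_fin exprn_ge0.
  + exact: above_ge0.
- by move=> j; rewrite lee_fin exprn_ge0.
- by move=> j; apply: iter_stay_ge0; exact: above_ge0.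
Qed.

(** A double sum over the times of records [k] and [k.+1]. After exchanging the sums, the waiting
    time between the two records ranges freely and rebuilds [next_record]. *)
Lemma record_meanS k F : (forall z, 0 <= F z)%E -> measurable_fun [set: R * R] F ->
  record_mean k.+1 F = record_mean k (next_record F).
Proof.
move=> F0 mF; have aF0 := above_ge0 F0; have maF := measurable_above F0 mF.
pose c s j := record_at s k (iter j stay (above F)).
have c0 s j : (0 <= c s j)%E by apply: record_at_ge0; exact: iter_stay_ge0.
(* Record [k] is set at [s] and record [k.+1] at [t.+1]; padding by zero makes the triangular sum a
   full double series. *)
pose u s t := if (s <= t)%N then c s (t - s)%N else 0%E.
have u0 s t : (0 <= u s t)%E by rewrite /u; case: ifP.
transitivity (\sum_(t <oo) \sum_(s <oo) u s t)%E.
  rewrite /record_mean nneseries_recl; [|by move=> t _; exact: record_at_ge0|by []].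
  rewrite record_at0 add0e -nneseries_addn; last by move=> t; exact: record_at_ge0.
  apply: eq_eseriesr => t _; rewrite addn1 record_atS// occupationE//.
  rewrite (nneseries_split 0 t.+1)//= add0n [X in (_ + X)%E]eseries0; last first.
    by move=> s ts _; rewrite /u leqNgt ts.
  rewrite adde0 big_mkord; apply: eq_bigr => s _.
  by rewrite /u -ltnS ltn_ord.
rewrite nneseries_interchange//; apply: eq_eseriesr => s _.
transitivity (\sum_(j <oo) c s j)%E.
  rewrite (nneseries_split 0 s)//= add0n big_nat big1 ?add0e; last first.
    by move=> t /andP[_ ts]; rewrite /u leqNgt ts.
  rewrite -nneseries_addn//; apply: eq_eseriesr => j _.
  by rewrite /u leq_addl addnK.
rewrite /c /record_at -integral_nneseries//.
- apply: eq_integral => w _; case: ifP => _; first by [].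
  by rewrite eseries0.
- move=> j; apply: measurable_fun_ifT => //.
  + exact: measurable_record_time.
  + by apply: measurableT_comp; [exact: measurable_iter_stay|exact: measurable_fun_pair].
- by move=> j w _; case: ifP => // _; exact: iter_stay_ge0.
Qed.

End record_law.

Lemma mem_itvcy {R : realType} (a z : R) : (z \in `[a, +oo[%classic) = (a <= z).
Proof. by apply/idP/idP; rewrite inE/= in_itv/= andbT. Qed.

(** * Exponential observations *)

Section density.
Context {d} {T : measurableType d} {R : realType}.
Variables (mu nu : {measure set T -> \bar R}) (f : T -> R).
Hypothesis f0 : forall x, 0 <= f x.
Hypothesis mf : measurable_fun [set: T] f.
Hypothesis nuE : forall A, measurable A -> nu A = (\int[mu]_(x in A) (f x)%:E)%E.

Import HBNNSimple.

(** The density is given only through the measures of sets. Both sides are limits along the same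
    increasing simple functions by monotone convergence, and for these the identity is linear in
    indicators. *)
Lemma ge0_integral_density (g : T -> \bar R) :
  measurable_fun [set: T] g -> (forall x, 0 <= g x)%E ->
  (\int[nu]_x g x = \int[mu]_x (g x * (f x)%:E))%E.
Proof.
move=> mg g0; pose h := nnsfun_approx measurableT mg.
have mfE : measurable_fun [set: T] (EFin \o f) by exact/measurable_EFinP.
have -> : (\int[nu]_x g x = lim (\int[nu]_x (h n x)%:E @[n --> \oo]))%E.
  have gE x : g x = limn (fun n => (h n x)%:E).
    by apply/esym/cvg_lim => //; exact: cvg_nnsfun_approx.
  under eq_integral do rewrite gE.
  apply: monotone_convergence => //.
  - by move=> n; exact/measurable_EFinP.
  - by move=> n x _; rewrite lee_fin.
  - by move=> x _ a b ab; rewrite lee_fin; exact/lefP/nd_nnsfun_approx.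
have -> : (\int[mu]_x (g x * (f x)%:E) =
    lim (\int[mu]_x ((h n x)%:E * (f x)%:E) @[n --> \oo]))%E.
  have gE x : (g x * (f x)%:E)%E = limn (fun n => (h n x)%:E * (f x)%:E)%E.
    by apply/esym/cvg_lim => //; apply: cvgeZr => //; exact: cvg_nnsfun_approx.
  under eq_integral do rewrite gE.
  apply: monotone_convergence => //.
  - by move=> n; apply: emeasurable_funM => //; exact/measurable_EFinP.
  - by move=> n x _; rewrite mule_ge0// lee_fin.
  - by move=> x _ a b ab; rewrite lee_wpmul2r// lee_fin//; exact/lefP/nd_nnsfun_approx.
congr (limn _); apply/funext => n.
transitivity (\sum_(y \in range (h n)) (y%:E * nu (h n @^-1` [set y])))%E.
  by rewrite integralT_nnsfun sintegralE.
transitivity (\int[mu]_x \sum_(y \in range (h n))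
    ((y * \1_(h n @^-1` [set y]) x)%:E * (f x)%:E))%E; last first.
  apply: eq_integral => x _; rewrite [in RHS](fimfunE (h n)) -fsumEFin//.
  by rewrite ge0_mule_fsuml// => y; exact: nnfun_muleindic_ge0.
rewrite ge0_integral_fsum//; last 2 first.
- by move=> y; apply: emeasurable_funM => //; exact/measurable_EFinP/measurable_funM.
- by move=> y x _; rewrite mule_ge0 ?lee_fin//; have := nnfun_muleindic_ge0 (h n) y x; rewrite lee_fin.
apply: eq_fsbigr => y /[!inE] -[x _ <-].
have mA : measurable (h n @^-1` [set h n x]) by exact: measurable_sfunP.
rewrite nuE// [in LHS]integral_mkcond -ge0_integralZl_EFin//; last 2 first.
- by move=> z _; rewrite patchE; case: ifP; rewrite ?lee_fin.
- by apply/(measurable_restrictT _ mA); exact: measurable_funTS.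
apply: eq_integral => z _; rewrite patchE indicE; case: ifPn => zA.
  by rewrite mulr1.
by rewrite mulr0 mule0 mul0e.
Qed.

End density.

Lemma lebesgue_measure_shift {R : realType} (y : R) (A : set R) : measurable A ->
  pushforward lebesgue_measure (fun z : measurableTypeR R => y + z : measurableTypeR R) A
  = lebesgue_measure A.
Proof.
have mshift : measurable_fun [set: measurableTypeR R] (fun z : measurableTypeR R => y + z : measurableTypeR R).
  exact: measurable_funD.
move=> mA; apply/esym/lebesgue_measure_unique => //= _ [[a b]] _ <-.
rewrite /pushforward (_ : _ @^-1` _ = `]a - y, b - y]%classic).
  rewrite !lebesgue_measure_itv/= !lte_fin ltrD2r.
  by case: ifP => // _; rewrite -!EFinB; congr (_%:E); lra.
by apply/seteqP; split=> z /=; rewrite !in_itv/= ltrBlDl lerBrDl.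
Qed.

Lemma ge0_integral_shift {R : realType} (y : R) (g : R -> \bar R) :
  measurable_fun [set: R] g -> (forall z, 0 <= g z)%E ->
  (\int[lebesgue_measure]_(z in `[y, +oo[) g z =
   \int[lebesgue_measure]_(z in `[0%R, +oo[) g (y + z)%R)%E.
Proof.
move=> mg g0.
have mshift : measurable_fun [set: measurableTypeR R] (fun z : measurableTypeR R => y + z : measurableTypeR R).
  exact: measurable_funD.
rewrite [LHS](eq_measure_integral (pushforward lebesgue_measure
   (fun z : measurableTypeR R => y + z : measurableTypeR R))); last first.
  by move=> A mA _; apply/esym; exact: lebesgue_measure_shift.
rewrite ge0_integral_pushforward//; last exact: measurable_funTS.
congr (integral _ _ _).
by apply/seteqP; split=> z /=; rewrite !in_itv/= !andbT lerDl.
Qed.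

(** The mean of [phi (u + Z)] with [Z] exponential of rate [lam]. Its [k]-fold iterate at 0 averages
    [phi] over a sum of [k] independent such variables, that is, over a Gamma law. *)
Definition waiting_mean {R : realType} (lam : R) (phi : R -> \bar R) (u : R) : \bar R :=
  (\int[lebesgue_measure]_(z in `[0%R, +oo[) (phi (u + z)%R * (lam * expR (- lam * z))%:E))%E.

(** * Transition operator of exponential waiting times *)

Section waiting_mean_theory.
Context {R : realType}.
Variable lam : R.
Hypothesis lam0 : 0 < lam.
Implicit Types phi psi : R -> \bar R.

Let measurable_expo : measurable_fun [set: R] (fun z => (lam * expR (- lam * z))%:E).
Proof.
apply/measurable_EFinP; apply: measurable_funM => //.
by apply: measurableT_comp => //; exact: measurable_funM.
Qed.

Let expo_ge0 (z : R) : (0 <= (lam * expR (- lam * z))%:E :> \bar R)%E.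
Proof. by rewrite lee_fin mulr_ge0// ?expR_ge0// ltW. Qed.

Lemma waiting_mean_ge0 phi u : (forall z, 0 <= phi z)%E -> (0 <= waiting_mean lam phi u)%E.
Proof. by move=> phi0; apply: integral_ge0 => z _; rewrite mule_ge0. Qed.

Lemma measurable_waiting_mean phi : (forall z, 0 <= phi z)%E ->
  measurable_fun [set: R] phi -> measurable_fun [set: R] (waiting_mean lam phi).
Proof.
move=> phi0 mphi.
pose f (p : R * R) := if 0 <= p.2 then (phi (p.1 + p.2)%R * (lam * expR (- lam * p.2))%:E)%E else 0%E.
rewrite (_ : waiting_mean lam phi = fun u => (\int[lebesgue_measure]_z f (u, z))%E); last first.
  apply/funext => u; rewrite /waiting_mean integral_mkcond; apply: eq_integral => z _.
  by rewrite patchE /f/= mem_itvcy.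
apply: (@measurable_fun_fubini_tonelli_F _ _ _ _ _ lebesgue_measure f); last first.
  by move=> p; rewrite /f; case: ifP => // _; rewrite mule_ge0.
apply: measurable_fun_ifT => //; first exact: measurable_fun_ler.
apply: emeasurable_funM.
  by apply: measurableT_comp => //; exact: measurable_funD.
exact: (measurableT_comp measurable_expo measurable_snd).
Qed.

Variable mu : {measure set R -> \bar R}.
Hypothesis muE : forall A, measurable A -> mu A = exponential_prob lam A.

Lemma ge0_integral_exponential phi : (forall z, 0 <= phi z)%E ->
  measurable_fun [set: R] phi -> (\int[mu]_z phi z = waiting_mean lam phi 0)%E.
Proof.
move=> phi0 mphi.
(* [lebesgue_measure] lives on the copy [measurableTypeR R] of [R], to which
   [mu] has to be transported. *)
pose toR (z : R) : measurableTypeR R := z.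
have mtoR : measurable_fun [set: R] toR by move=> _ A mA; rewrite setTI.
transitivity (@integral _ (measurableTypeR R) R (pushforward mu toR) setT phi).
  by rewrite [RHS](ge0_integral_pushforward mtoR).
rewrite (@ge0_integral_density _ (measurableTypeR R) R lebesgue_measure _ (exponential_pdf lam))//.
- rewrite /waiting_mean [RHS]integral_mkcond; apply: eq_integral => z _.
  rewrite patchE /exponential_pdf patchE add0r; case: ifP => // _.
  by rewrite mule0.
- by move=> z; rewrite exponential_pdf_ge0// ltW.
- exact: measurable_exponential_pdf.
Qed.

(** Translating the integral by [y] factors the survival probability [expR (- lam * y)] out of the
    exponential density; [0 <= y] keeps the domain inside the support. *)
Lemma exponential_memoryless phi y : 0 <= y -> (forall z, 0 <= phi z)%E ->
  measurable_fun [set: R] phi ->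
  (\int[mu]_z (if (y <= z)%R then phi z else 0) =
   (expR (- lam * y))%:E * waiting_mean lam phi y)%E.
Proof.
move=> y0 phi0 mphi.
rewrite ge0_integral_exponential; last 2 first.
- by move=> z; case: ifP.
- by apply: measurable_fun_ifT => //; exact: measurable_fun_ler.
transitivity (\int[lebesgue_measure]_(z in `[y, +oo[) (phi z * (lam * expR (- lam * z))%:E))%E.
  rewrite /waiting_mean integral_mkcond [RHS]integral_mkcond.
  apply: eq_integral => z _; rewrite !patchE !mem_itvcy add0r.
  have [yz|zy] := leP y z.
    by rewrite (le_trans y0 yz).
  by case: ifP => // _; rewrite mul0e.
rewrite ge0_integral_shift; last 2 first.
- exact: emeasurable_funM.
- by move=> z; rewrite mule_ge0.
rewrite -ge0_integralZl_EFin ?expR_ge0//.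
- apply: eq_integral => z _; rewrite mulrDr expRD mulrCA EFinM.
  by rewrite muleCA.
- by move=> z _; rewrite mule_ge0.
- apply: measurable_funTS; apply: emeasurable_funM => //.
  by apply: measurableT_comp => //; exact: measurable_funD.
Qed.

Lemma waiting_mean1 u : waiting_mean lam (cst 1%E) u = 1%E.
Proof.
rewrite -[RHS](integral_exponential_pdf lam0) /waiting_mean integral_mkcond.
apply: eq_integral => z _; rewrite patchE /exponential_pdf patchE.
by case: ifP => // _; rewrite /= mul1e.
Qed.

End waiting_mean_theory.

Lemma iter_waiting_mean_ge0 {R : realType} (lam : R) phi k : 0 < lam ->
  (forall z, 0 <= phi z)%E -> forall z, (0 <= iter k (waiting_mean lam) phi z)%E.
Proof. by move=> lam0 phi0; elim: k => //= k IH z; exact: waiting_mean_ge0. Qed.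

Lemma measurable_iter_waiting_mean {R : realType} (lam : R) phi k : 0 < lam ->
  (forall z, 0 <= phi z)%E -> measurable_fun [set: R] phi ->
  measurable_fun [set: R] (iter k (waiting_mean lam) phi).
Proof.
move=> lam0 phi0 mphi; elim: k => //= k IH; apply: measurable_waiting_mean => //.
exact: iter_waiting_mean_ge0.
Qed.

Lemma iter_waiting_mean1 {R : realType} (lam : R) k u : 0 < lam ->
  iter k (waiting_mean lam) (cst 1%E) u = 1%E.
Proof.
move=> lam0; elim: k u => //= k IH u.
rewrite (_ : iter k _ _ = cst 1%E); first exact: waiting_mean1.
exact/funext.
Qed.

(** At each step [lam * expR (- lam * z)] is [lam * expR ((1 - lam) * z)] times the unit-rate
    density. The tilts of the steps multiply to a tilt of the total displacement, so the endpoint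
    carries the weight and the prefactor corrects for the start [u]. *)
Lemma iter_waiting_mean_tilt {R : realType} (lam : R) phi k u : 0 < lam ->
  (forall z, 0 <= phi z)%E -> measurable_fun [set: R] phi ->
  iter k (waiting_mean lam) phi u =
  ((lam ^+ k * expR ((lam - 1) * u))%:E *
   iter k (waiting_mean 1) (fun z => (expR ((1 - lam) * z))%:E * phi z) u)%E.
Proof.
move=> lam0 phi0 mphi; set psi := fun z => _.
have psi0 z : (0 <= psi z)%E by rewrite mule_ge0// lee_fin expR_ge0.
have mpsi : measurable_fun [set: R] psi.
  apply: emeasurable_funM => //; apply/measurable_EFinP.
  by apply: measurableT_comp => //; exact: measurable_funM.
elim: k u => [|k IH] u /=.
  rewrite expr0 mul1r /psi muleA -EFinM -expRD -mulrDl.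
  by rewrite addrC subrKA subrr mul0r expR0 mul1e.
rewrite [in RHS]/waiting_mean -ge0_integralZl_EFin; last 4 first.
- by [].
- by move=> z _; rewrite mule_ge0 ?iter_waiting_mean_ge0 ?lee_fin ?mulr_ge0 ?expR_ge0.
- apply: measurable_funTS; apply: emeasurable_funM.
    apply: measurableT_comp; first exact: measurable_iter_waiting_mean.
    exact: measurable_funD.
  apply/measurable_EFinP; apply: measurable_funM => //.
  by apply: measurableT_comp => //; exact: measurable_funM.
- by rewrite mulr_ge0 ?expR_ge0// exprn_ge0// ltW.
apply: eq_integral => z _; rewrite IH.
rewrite muleAC -EFinM muleC [in RHS]muleCA -EFinM; congr (_ * _%:E)%E.
have E : expR ((lam - 1) * (u + z)) * expR (- lam * z) =
    expR ((lam - 1) * u) * expR (- 1 * z) by rewrite -!expRD; congr expR; ring.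
transitivity (lam ^+ k * lam * (expR ((lam - 1) * (u + z)) * expR (- lam * z))).
  by ring.
by rewrite E exprS; ring.
Qed.

(** * Law of the record range *)

Section record_range_law.
Context {d} {T : measurableType d} {R : realType}.
Variables (P : probability T R) (X : nat -> {mfun T >-> R}) (lam : R).
Hypothesis lam0 : 0 < lam.
Hypothesis indepX : mutually_independent P X.
Hypothesis lawX : forall i A, measurable A ->
  distribution P (X i) A = exponential_prob lam A.

Let mu : probability R R := distribution P (X 0%N).

Let muE A : measurable A -> mu A = exponential_prob lam A.
Proof. exact: lawX. Qed.

Let lawX_mu i A : measurable A -> distribution P (X i) A = mu A.
Proof. by move=> mA; rewrite muE// lawX. Qed.

Let tailE y : 0 <= y -> mu `[y, +oo[%classic = (expR (- lam * y))%:E.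
Proof.
move=> y0; rewrite -(mule1 (expR _)%:E) -[X in (_ * X)%E](waiting_mean1 lam0 y).
rewrite -(exponential_memoryless lam0 muE)//.
rewrite -[in LHS](setIT `[y, +oo[%classic) -integral_indic//.
by apply: eq_integral => z _; rewrite indicE mem_itvcy; case: ifP.
Qed.

Let tail_neq0 y : mu `[y, +oo[%classic != 0%E.
Proof.
rewrite gt_eqF//; have [y0|/ltW y0] := leP 0 y.
  by rewrite tailE// lte_fin expR_gt0.
apply: (@lt_le_trans _ _ (mu `[0%R, +oo[%classic)).
  by rewrite tailE// lte_fin expR_gt0.
by rewrite le_measure ?inE//; apply: subset_itvr; rewrite bnd_simp.
Qed.

(** Lack of memory: the normalisation in [next_recordE] cancels the survival factor, and the
    increment over the current record is a fresh exponential. The identity is confined to [0 <= y],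
    where the tail is exponential. *)
Let next_record_waiting (F : R * R -> \bar R) (phi : R -> \bar R) :
  (forall z, 0 <= F z)%E -> measurable_fun [set: R * R] F ->
  (forall z, 0 <= phi z)%E -> measurable_fun [set: R] phi ->
  (forall x y, 0 <= y -> F (x, y) = phi (y - x)) ->
  forall x y, 0 <= y -> next_record mu F (x, y) = waiting_mean lam phi (y - x).
Proof.
move=> F0 mF phi0 mphi Fphi x y y0.
rewrite (next_recordE tail_neq0)//= /record_tail tailE//=.
rewrite /above/= (exponential_memoryless lam0 muE (phi := fun z => F (x, z)))//; last first.
  by apply: measurableT_comp => //; exact: measurable_fun_pair.
rewrite muleA -EFinM mulVf ?mul1e ?gt_eqF ?expR_gt0//.
apply: eq_integral => z; rewrite inE/= in_itv/= andbT => z0.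
by rewrite Fphi ?addr_ge0// addrAC.
Qed.

Let Fd (phi : R -> \bar R) (z : R * R) := phi (z.2 - z.1).

Let iter_next_record phi k :
  (forall z, 0 <= phi z)%E -> measurable_fun [set: R] phi ->
  [/\ forall z, (0 <= iter k (next_record mu) (Fd phi) z)%E,
      measurable_fun [set: R * R] (iter k (next_record mu) (Fd phi)) &
      forall x y, 0 <= y -> iter k (next_record mu) (Fd phi) (x, y) =
        iter k (waiting_mean lam) phi (y - x)].
Proof.
move=> phi0 mphi; elim: k => [|k [F0 mF FE]] /=.
  split=> //; first by move=> z; exact: phi0.
  by apply: measurableT_comp => //; exact: measurable_funB.
split; first exact: next_record_ge0.
  exact: measurable_next_record.
apply: next_record_waiting => //; first exact: iter_waiting_mean_ge0.
exact: measurable_iter_waiting_mean.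
Qed.

Let record_mean_iter k F : (forall z, 0 <= F z)%E -> measurable_fun [set: R * R] F ->
  record_mean P X k F = record_mean P X 0 (iter k (next_record mu) F).
Proof.
elim: k F => [|k IH] F F0 mF; first by rewrite /=.
rewrite (record_meanS indepX lawX_mu k F0 mF) iterSr.
exact: (IH _ (next_record_ge0 mu F0) (measurable_next_record mu F0 mF)).
Qed.

(** Places the start of the chain, almost surely, in the region where lack of memory holds. *)
Let X0_ge0 : {ae P, forall w, 0 <= X 0%N w}.
Proof.
exists (X 0%N @^-1` `]-oo, 0[%classic); split.
- by rewrite -[X in measurable X]setTI; exact: measurable_funPT.
- transitivity (mu `]-oo, 0[%classic) => //.
  rewrite muE// /exponential_prob; apply: integral0_eq => z /=.
  by rewrite in_itv/= => z0; rewrite lt0_exponential_pdf.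
- by move=> w /= /negP; rewrite in_itv/= ltNge.
Qed.

Let record_mean_waiting k phi :
  (forall z, 0 <= phi z)%E -> measurable_fun [set: R] phi ->
  record_mean P X k (Fd phi) = iter k (waiting_mean lam) phi 0.
Proof.
move=> phi0 mphi; have [F0 mF FE] := iter_next_record k phi0 mphi.
rewrite record_mean_iter; last 2 first.
- by move=> z; exact: phi0.
- by apply: measurableT_comp => //; exact: measurable_funB.
(* Record 0 occurs only at time 0, where the gap to the first observation is zero; only that term of
   the series survives. *)
rewrite /record_mean nneseries_recl//; last by move=> t _; exact: record_at_ge0.
rewrite eseries0; last by case=> // t _ _; rewrite record_at_first.
rewrite adde0 /record_at.
transitivity (\int[P]_w (cst (iter k (waiting_mean lam) phi 0%R) w))%E; last first.
  rewrite integral_cst// -[RHS]mule1; congr (_ * _)%E; exact: probability_setT.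
apply: ge0_ae_eq_integral => //.
- by apply: measurableT_comp => //; exact: measurable_fun_pair.
- by move=> w _; exact: iter_waiting_mean_ge0.
- by apply: filterS X0_ge0 => w X0w _ /=; rewrite FE// subrr.
Qed.

(** At most one term is nonzero, so this is [phi] of the record range when record [k] exists and 0
    otherwise, in a form that can be measured and integrated term by term. *)
Let record_sum k phi w : \bar R :=
  (\sum_(t <oo) if record_time (fun i => X i w) k == Some t
                then Fd phi (X 0%N w, X t w) else 0)%E.

Let record_sum_some k phi w t : (forall z, 0 <= phi z)%E ->
  record_time (fun i => X i w) k = Some t -> record_sum k phi w = phi (X t w - X 0%N w).
Proof.
move=> phi0 E; rewrite /record_sum (@nneseriesD1 _ _ t)//; last first.
  by move=> s _; case: ifP => // _; exact: phi0.
rewrite E eqxx eseries0 ?adde0// => s _ st; case: eqP => // -[ts].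
by rewrite ts eqxx in st.
Qed.

Let record_sum_none k phi w :
  record_time (fun i => X i w) k = None -> record_sum k phi w = 0%E.
Proof. by move=> E; apply: eseries0 => t _ _; rewrite E. Qed.

Let measurable_record_term k t phi : measurable_fun [set: R] phi ->
  measurable_fun [set: T] (fun w => if record_time (fun i => X i w) k == Some t
                then Fd phi (X 0%N w, X t w) else 0%E).
Proof.
move=> mphi; apply: measurable_fun_ifT => //.
  exact: measurable_record_time.
apply: measurableT_comp; last exact: measurable_fun_pair.
by apply: measurableT_comp => //; exact: measurable_funB.
Qed.

Let record_term_ge0 k t phi w : (forall z, 0 <= phi z)%E ->
  (0 <= if record_time (fun i => X i w) k == Some t
        then Fd phi (X 0%N w, X t w) else 0)%E.
Proof. by move=> phi0; case: ifP => // _; exact: phi0. Qed.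

Let measurable_record_sum k phi : (forall z, 0 <= phi z)%E ->
  measurable_fun [set: R] phi -> measurable_fun [set: T] (record_sum k phi).
Proof.
move=> phi0 mphi; apply: ge0_emeasurable_sum => [t w _ _|t _].
  exact: record_term_ge0.
exact: measurable_record_term.
Qed.

Let integral_record_sum k phi : (forall z, 0 <= phi z)%E ->
  measurable_fun [set: R] phi ->
  (\int[P]_w record_sum k phi w = iter k (waiting_mean lam) phi 0%R)%E.
Proof.
move=> phi0 mphi; rewrite integral_nneseries//; first exact: record_mean_waiting.
- by move=> t; exact: measurable_record_term.
- by move=> t w _; exact: record_term_ge0.
Qed.

Lemma measurable_record_range n :
  measurable_fun [set: T] (fun w => record_range (fun i => X i w) n).
Proof.
(* [record_sum] is handled for nonnegative functions; the absolute value is the identity on the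
   nonnegative range, and a missing record gives 0 on both sides. *)
apply/measurable_EFinP; pose phi (r : R) := `|r|%:E.
have phi0 r : (0 <= phi r)%E by rewrite lee_fin.
rewrite (_ : EFin \o _ = record_sum n.-1 phi).
  apply: measurable_record_sum => //.
  by apply/measurable_EFinP; exact: normr_measurable.
apply/funext => w /=; rewrite -[in LHS](ger0_norm (record_range_ge0 _ _)) /record_range/=.
case E : record_time => [t|]; first by rewrite (record_sum_some phi0 E).
by rewrite record_sum_none// normr0.
Qed.

(** For the constant function 1, [record_sum] is the indicator that record [k] exists; its mean is
    the total mass 1 of [k] exponential steps. *)
Let record_time_ae k : {ae P, forall w, record_time (fun i => X i w) k != None}.
Proof.
pose one : R -> \bar R := cst 1%E.
have one0 z : (0 <= one z)%E by rewrite lee01.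
have sumE w : record_sum k one w = (\1_[set w | record_time (fun i => X i w) k != None] w)%:E.
  rewrite indicE; case E : (record_time (fun i => X i w) k) => [t|].
    by rewrite (record_sum_some one0 E) mem_set//= E.
  by rewrite record_sum_none// memNset//= E.
set A := [set _ | _] in sumE.
have mA : measurable A.
  rewrite (_ : A = [set: T] `&` record_sum k one @^-1` [set 1%E]).
    by apply: measurable_record_sum.
  rewrite setTI; apply/seteqP; split=> w /=; rewrite sumE indicE => Aw.
    by rewrite mem_set.
  by apply/set_mem; move: Aw; case: (_ \in A) => // -[/eqP]; rewrite eq_sym oner_eq0.
have PA : P A = 1%E.
  rewrite -(iter_waiting_mean1 k 0 lam0) -/one -integral_record_sum//.
  under eq_integral do rewrite sumE.
  by rewrite integral_indic// setIT.
exists (~` A); split => //; first exact: measurableC.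
by rewrite probability_setC// PA subee.
Qed.

Lemma record_range_law k phi :
  (forall z, 0 <= phi z)%E -> measurable_fun [set: R] phi ->
  (\int[P]_w phi (record_range (fun i => X i w) k.+1) = iter k (waiting_mean lam) phi 0%R)%E.
Proof.
move=> phi0 mphi; rewrite -integral_record_sum//.
apply: ge0_ae_eq_integral => //.
- by apply: measurableT_comp => //; exact: measurable_record_range.
- exact: measurable_record_sum.
- by move=> w _; apply: nneseries_ge0 => t _ _; exact: record_term_ge0.
apply: filterS (record_time_ae k) => w + _; rewrite /record_range/=.
by case E : record_time => [t|//] _; rewrite (record_sum_some phi0 E).
Qed.

End record_range_law.

Lemma is_derive_mull {R : realType} (f : R -> R) (a x df : R) :
  is_derive x 1 f df -> is_derive x 1 (fun z => a * f z) (a * df).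
Proof. exact: is_deriveZ. Qed.

(** * Karlin's argument *)

Lemma derive_ge0_le {R : realType} (f df : R -> R) (a b : R) : a <= b ->
  (forall x, a <= x <= b -> is_derive x 1 f (df x)) ->
  (forall x, a <= x <= b -> 0 <= df x) -> f a <= f b.
Proof.
move=> ab dfE df0.
have cf : {within `[a, b], continuous f}.
  apply: derivable_within_continuous => x; rewrite in_itv/= => /dfE[//].
have [|c cab E] := @MVT_segment R f df a b ab _ cf.
  by move=> x; rewrite in_itv/= => /andP[/ltW ax /ltW xb]; apply: dfE; rewrite ax.
by rewrite -subr_ge0 E mulr_ge0 ?subr_ge0// df0.
Qed.

(* -1/psi grows at least like a primitive of [a], so psi cannot be positive
   somewhere, because [a] has infinite integral at +oo, nor negative
   somewhere, because [a] has infinite integral at 0. *)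
Lemma riccati_eq0 {R : realType} (psi dpsi a : R -> R) (a0 a1 : R) :
  0 < a0 -> 0 < a1 ->
  (forall x : R, 0 < x -> is_derive x 1 psi (dpsi x)) ->
  (forall x : R, 0 < x -> a x * psi x ^+ 2 <= dpsi x) ->
  (forall x : R, 0 < x -> a0 <= a x) ->
  (forall x : R, 0 < x <= 1 -> a1 / x <= a x) ->
  forall x : R, 0 < x -> psi x = 0.
Proof.
move=> a00 a10 dpsiE dpsi_ge a_ge0 a_ge1 x0 x0_gt0.
have mono x y : 0 < x -> x <= y -> psi x <= psi y.
  move=> x_gt0 xy; apply: (derive_ge0_le (df := dpsi)) => // z /andP[xz _].
    by apply: dpsiE; exact: lt_le_trans xz.
  have z_gt0 : 0 < z by exact: lt_le_trans xz.
  apply: le_trans (dpsi_ge _ z_gt0); rewrite mulr_ge0 ?sqr_ge0//.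
  exact: le_trans (ltW a00) (a_ge0 _ z_gt0).
have dinv (x : R) : 0 < x -> psi x != 0 ->
    is_derive x 1 (fun z => - (psi z)^-1) (dpsi x / psi x ^+ 2).
  move=> x_gt0 psi_neq0; have [drv <-] := dpsiE _ x_gt0.
  apply: DeriveDef; first by apply: derivableN; exact: derivableV.
  rewrite deriveN; last exact: derivableV.
  by rewrite deriveV// scaleNr opprK mulrC.
have dquot (x : R) : 0 < x -> psi x != 0 -> a x <= dpsi x / psi x ^+ 2.
  by move=> x_gt0 psi_neq0; rewrite ler_pdivlMr ?dpsi_ge// exprn_even_gt0.
case: (ltgtP (psi x0) 0) => // psi0; exfalso.
  (* The lower bound [a1 / x] on [a] is available only up to 1. *)
  pose y0 := Num.min x0 1.
  have y0_gt0 : 0 < y0 by rewrite lt_min x0_gt0 ltr01.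
  have psiy0 : psi y0 < 0 by apply: le_lt_trans psi0; apply: mono => //; rewrite ge_min lexx.
  (* Chosen so that [a1 * (ln y0 - ln y)] equals [- (psi y0)^-1]: integrating down to [y] forces
     [- (psi y)^-1 <= 0], against [psi y < 0]. *)
  pose y := y0 * expR (- (- psi y0)^-1 / a1).
  have y_gt0 : 0 < y by rewrite mulr_gt0 ?expR_gt0.
  have yy0 : y <= y0.
    apply: ler_piMr; first exact: ltW.
    rewrite -[leRHS]expR0 ler_expR mulNr oppr_le0.
    by rewrite divr_ge0 ?invr_ge0 ?oppr_ge0 ?ltW.
  have psineg z : z <= y0 -> 0 < z -> psi z < 0.
    by move=> zy0 z_gt0; apply: le_lt_trans psiy0; exact: mono.
  have pos z : y <= z <= y0 -> 0 < z by move=> /andP[yz _]; exact: lt_le_trans yz.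
  have le_y : - (psi y)^-1 - a1 * ln y <= - (psi y0)^-1 - a1 * ln y0.
    apply: (derive_ge0_le (f := fun z => - (psi z)^-1 - a1 * ln z)
      (df := fun z => dpsi z / psi z ^+ 2 - a1 * z^-1)) => // z zy;
      have z_gt0 := pos _ zy; have [_ zy0] := andP zy.
    apply: is_deriveB; first by apply: dinv => //; rewrite lt_eqF// psineg.
    by apply: is_derive_mull; exact: is_derive1_ln.
    rewrite subr_ge0; apply: le_trans (dquot _ z_gt0 _).
      by apply: a_ge1; rewrite z_gt0 (le_trans zy0)// ge_min lexx orbT.
    by rewrite lt_eqF// psineg.
  move: le_y; rewrite {2}/y lnM ?posrE ?expR_gt0// expRK => le_y.
  have psiy : psi y < 0 by exact: psineg.
  have : 0 < - (psi y)^-1 by rewrite oppr_gt0 invr_lt0.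
  apply/negP; rewrite -leNgt.
  have E : a1 * (- (- psi y0)^-1 / a1) = - (- psi y0)^-1.
    by rewrite mulrCA mulfV ?mulr1// gt_eqF.
  move: le_y; rewrite -/y mulrDr E invrN; lra.
(* The distance at which linear growth of rate [a0] brings [- (psi x0)^-1] up to 0, against
   [0 < psi y]. *)
pose y := x0 + (psi x0)^-1 / a0.
have yx0 : x0 <= y by rewrite lerDl divr_ge0 ?invr_ge0 ?ltW.
have pos z : x0 <= z <= y -> 0 < z by move=> /andP[xz _]; exact: lt_le_trans xz.
have psipos z : x0 <= z <= y -> 0 < psi z.
  by move=> /andP[xz _]; apply: lt_le_trans psi0 _; exact: mono.
have le_y : - (psi x0)^-1 - a0 * x0 <= - (psi y)^-1 - a0 * y.
  apply: (derive_ge0_le (f := fun z => - (psi z)^-1 - a0 * z)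
    (df := fun z => dpsi z / psi z ^+ 2 - a0 * 1)) => // z zy; have z_gt0 := pos _ zy.
  apply: is_deriveB; first by apply: dinv => //; rewrite gt_eqF// psipos.
  rewrite mulr1 subr_ge0; apply: le_trans (dquot _ z_gt0 _); first exact: a_ge0.
  by rewrite gt_eqF// psipos.
have : 0 < (psi y)^-1 by rewrite invr_gt0 psipos// yx0 lexx.
have E : a0 * y = a0 * x0 + (psi x0)^-1.
  by rewrite mulrDr mulrCA mulfV ?mulr1// gt_eqF.
move: le_y; rewrite E; lra.
Qed.

(** * From risk dominance to the Riccati inequality *)

Section karlin.
Context {d} {T : measurableType d} {R : realType}.
Variables (Q : probability T R) (Y : T -> R) (k : nat).
Hypothesis mY : measurable_fun [set: T] Y.
Hypothesis Y0 : forall w, 0 <= Y w.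

(** Likelihood ratio of rate [x] to rate 1, up to the factor [x ^+ k] that [mass] supplies. *)
Let e (x : R) (w : T) : R := expR ((1 - x) * Y w).

Hypothesis mass : forall x, 0 < x -> (\int[Q]_w (e x w)%:E = (x ^- k)%:E)%E.

Let me x : measurable_fun [set: T] (e x).
Proof. by apply: measurableT_comp => //; exact: measurable_funM. Qed.

Let e_ge0 x w : 0 <= e x w. Proof. exact: expR_ge0. Qed.

Let sqe_ge0 a x w : 0 <= a ^+ 2 * e x w.
Proof. by rewrite mulr_ge0 ?sqr_ge0. Qed.

Let inte x : 0 < x -> Q.-integrable [set: T] (EFin \o e x).
Proof.
move=> x0; apply/integrableP; split; first exact/measurable_EFinP.
under eq_integral do rewrite /= ger0_norm ?e_ge0//.
by rewrite mass// ltry.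
Qed.

Let integrable_dom (f : T -> R) C x : 0 < x -> measurable_fun [set: T] f ->
  (forall w, `|f w| <= C * e x w) -> Q.-integrable [set: T] (EFin \o f).
Proof.
move=> x0 mf fC; apply: (le_integrable _ _ _ (integrableZl measurableT C (inte x0))) => //.
  exact/measurable_EFinP.
by move=> w _ /=; rewrite lee_fin (le_trans (fC w))// ler_norm.
Qed.

(** Halving the rate pays for a square: with [z] equal to [x / 4 * Y w], the square of [z] is at
    most [expR z ^+ 2], which is the ratio of the two weights. Second moments of [Y] thus follow
    from [mass] alone. *)
Let Y2e x w : 0 < x -> Y w ^+ 2 * e x w <= (4 / x) ^+ 2 * e (x / 2) w.
Proof.
move=> x0; pose z := x / 4 * Y w.
have z0 : 0 <= z by rewrite mulr_ge0// divr_ge0// ltW.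
have zle : z ^+ 2 <= expR (x / 2 * Y w).
  apply: (@le_trans _ _ (expR z ^+ 2)).
    rewrite lerXn2r ?nnegrE ?expR_ge0//.
    by apply: le_trans (expR_ge1Dx z); rewrite lerDr.
  by rewrite expr2 -expRD /z -mulrDl; rewrite (_ : x / 4 + x / 4 = x / 2)//; field.
have -> : Y w ^+ 2 * e x w = (4 / x) ^+ 2 * (z ^+ 2 * e x w).
  by rewrite /z; field; rewrite gt_eqF.
rewrite ler_wpM2l ?sqr_ge0//.
have -> : e (x / 2) w = expR (x / 2 * Y w) * e x w.
  by rewrite /e -expRD; congr expR; field.
by rewrite ler_wpM2r// e_ge0.
Qed.

Let e_half x w : 0 < x -> e x w <= e (x / 2) w.
Proof.
move=> x0; rewrite ler_expR ler_wpM2r//; lra.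
Qed.

Variables (g : T -> R) (m b : R).
Hypothesis mg : measurable_fun [set: T] g.
(** Error of the affine estimator at scale [x^-1]; the competitor has error [g + v]. *)
Let v x w := m * Y w + b - x^-1.
Hypothesis dom : forall x, 0 < x ->
  (\int[Q]_w ((g w + v x w) ^+ 2 * e x w)%:E <= \int[Q]_w (v x w ^+ 2 * e x w)%:E)%E.

Let mv x : measurable_fun [set: T] (v x).
Proof.
apply: measurable_funB => //; apply: measurable_funD => //.
exact: measurable_funM.
Qed.

Let intv2 x : 0 < x -> Q.-integrable [set: T] (fun w => (v x w ^+ 2 * e x w)%:E).
Proof.
move=> x0; have x20 : 0 < x / 2 by rewrite divr_gt0.
apply: (@integrable_dom _ (2 * m ^+ 2 * (4 / x) ^+ 2 + 2 * (b - x^-1) ^+ 2) (x / 2)) => //.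
  by apply: measurable_funM => //; exact: measurable_funX.
move=> w; rewrite ger0_norm ?sqe_ge0//.
apply: (@le_trans _ _ (2 * m ^+ 2 * (Y w ^+ 2 * e x w) + 2 * (b - x^-1) ^+ 2 * e x w)).
  rewrite mulrA -mulrDl ler_wpM2r ?e_ge0// /v.
  have := sqr_ge0 (m * Y w - (b - x^-1)); nra.
rewrite [leRHS]mulrDl; apply: lerD.
  rewrite -[leRHS]mulrA; apply: ler_wpM2l; last exact: Y2e.
  by rewrite mulr_ge0 ?sqr_ge0.
apply: ler_wpM2l; last exact: e_half.
by rewrite mulr_ge0 ?sqr_ge0.
Qed.

Let intY2 x : 0 < x -> Q.-integrable [set: T] (fun w => (Y w ^+ 2 * e x w)%:E).
Proof.
move=> x0; have x20 : 0 < x / 2 by rewrite divr_gt0.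
apply: (@integrable_dom _ ((4 / x) ^+ 2) (x / 2)) => //.
  by apply: measurable_funM => //; exact: measurable_funX.
by move=> w; rewrite ger0_norm ?Y2e ?sqe_ge0.
Qed.

Let intZ c (f : T -> R) : Q.-integrable [set: T] (EFin \o f) ->
  Q.-integrable [set: T] (EFin \o (fun w => c * f w)).
Proof. exact: integrableZl. Qed.

Let intD (f h : T -> R) : Q.-integrable [set: T] (EFin \o f) ->
  Q.-integrable [set: T] (EFin \o h) ->
  Q.-integrable [set: T] (EFin \o (fun w => f w + h w)).
Proof. exact: integrableD. Qed.

Let le_int (f h : T -> R) : measurable_fun [set: T] f ->
  Q.-integrable [set: T] (EFin \o h) -> (forall w, `|f w| <= h w) ->
  Q.-integrable [set: T] (EFin \o f).
Proof.
move=> mf ih fh; apply: (le_integrable _ _ _ ih) => //; first exact/measurable_EFinP.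
by move=> w _ /=; rewrite lee_fin (le_trans (fh w))// ler_norm.
Qed.

Let intgv2 x : 0 < x -> Q.-integrable [set: T] (fun w => ((g w + v x w) ^+ 2 * e x w)%:E).
Proof.
move=> x0; apply/integrableP; split.
  apply/measurable_EFinP/measurable_funM => //; apply: measurable_funX.
  exact: measurable_funD.
under eq_integral do rewrite /= ger0_norm ?sqe_ge0//.
apply: le_lt_trans (dom x0) _.
have /integrableP[_] := intv2 x0.
by under eq_integral do rewrite /= ger0_norm ?sqe_ge0//.
Qed.

Let intg2 x : 0 < x -> Q.-integrable [set: T] (fun w => (g w ^+ 2 * e x w)%:E).
Proof.
move=> x0.
apply: (@le_int _ (fun w => 2 * ((g w + v x w) ^+ 2 * e x w) + 2 * (v x w ^+ 2 * e x w))).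
- by apply: measurable_funM => //; exact: measurable_funX.
- by apply: intD; apply: intZ; [exact: intgv2|exact: intv2].
- move=> w; rewrite ger0_norm ?sqe_ge0// !mulrA -mulrDl.
  rewrite ler_wpM2r ?e_ge0//.
  (* This square is exactly the slack in bounding [g ^+ 2] by [2 * (g + v) ^+ 2 + 2 * v ^+ 2]. *)
  have := sqr_ge0 (g w + 2 * v x w); nra.
Qed.

Let intg x : 0 < x -> Q.-integrable [set: T] (fun w => (g w * e x w)%:E).
Proof.
move=> x0; apply: (@le_int _ (fun w => g w ^+ 2 * e x w + e x w)).
- exact: measurable_funM.
- by apply: intD; [exact: intg2|exact: inte].
- move=> w; rewrite normrM (ger0_norm (e_ge0 x w)).
  have -> : g w ^+ 2 * e x w + e x w = (g w ^+ 2 + 1) * e x w by ring.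
  rewrite ler_wpM2r ?e_ge0// -[g w ^+ 2]real_normK ?num_real//.
  have := sqr_ge0 (`|g w| - 1); have := normr_ge0 (g w); nra.
Qed.

Let intgY x : 0 < x -> Q.-integrable [set: T] (fun w => (g w * Y w * e x w)%:E).
Proof.
move=> x0; apply: (@le_int _ (fun w => g w ^+ 2 * e x w + Y w ^+ 2 * e x w)).
- by do 2 apply: measurable_funM => //.
- by apply: intD; [exact: intg2|exact: intY2].
- move=> w; rewrite normrM (ger0_norm (e_ge0 x w)) -mulrDl.
  rewrite ler_wpM2r ?e_ge0// normrM (ger0_norm (Y0 w)) -[g w ^+ 2]real_normK ?num_real//.
  have := sqr_ge0 (`|g w| - Y w); have := mulr_ge0 (normr_ge0 (g w)) (Y0 w); nra.
Qed.

Let L x := (\int[Q]_w (g w * e x w))%R.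
Let M x := (\int[Q]_w (g w * Y w * e x w))%R.
Let D x := (\int[Q]_w (g w ^+ 2 * e x w))%R.

Let Rintegral_lin (f1 f2 f3 f4 : T -> R) c2 c3 c4 :
  Q.-integrable [set: T] (EFin \o f1) -> Q.-integrable [set: T] (EFin \o f2) ->
  Q.-integrable [set: T] (EFin \o f3) -> Q.-integrable [set: T] (EFin \o f4) ->
  (\int[Q]_w (f1 w + (c2 * f2 w + (c3 * f3 w + c4 * f4 w))) =
   \int[Q]_w f1 w + (c2 * \int[Q]_w f2 w + (c3 * \int[Q]_w f3 w + c4 * \int[Q]_w f4 w)))%R.
Proof.
move=> i1 i2 i3 i4.
have i34 := intD (intZ c3 i3) (intZ c4 i4).
have i234 := intD (intZ c2 i2) i34.
rewrite RintegralD// RintegralD//; last exact: intZ.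
by rewrite RintegralD ?RintegralZl//; exact: intZ.
Qed.

(** Expanding the competitor's squared error, the finite risk [V] cancels; the cross term splits
    along [v] into [M] and [L]. *)
Let dominance x : 0 < x -> D x + 2 * (m * M x + (b - x^-1) * L x) <= 0.
Proof.
move=> x0; pose V := (\int[Q]_w (v x w ^+ 2 * e x w))%R.
have le : (\int[Q]_w ((g w + v x w) ^+ 2 * e x w) <= V)%R.
  rewrite fine_le ?dom//; apply: integrable_fin_num => //; [exact: intgv2|exact: intv2].
have E : (\int[Q]_w ((g w + v x w) ^+ 2 * e x w) =
    D x + (2 * m * M x + (2 * (b - x^-1) * L x + 1 * V)))%R.
  rewrite -Rintegral_lin; [|exact: intg2|exact: intgY|exact: intg|exact: intv2].
  by apply: eq_Rintegral => w _; rewrite /v; ring.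
move: le; rewrite E; lra.
Qed.

Let cauchy_schwarz x : 0 < x -> x ^+ k * L x ^+ 2 <= D x.
Proof.
(* The mean of [g] under the normalised tilted law; the variance around it is nonnegative. *)
move=> x0; pose c := x ^+ k * L x.
have xk0 : x ^+ k != 0 by rewrite expf_neq0// gt_eqF.
have mass' : (\int[Q]_w e x w)%R = x ^- k by rewrite /Rintegral mass.
have : 0 <= (\int[Q]_w ((g w - c) ^+ 2 * e x w))%R.
  by apply: Rintegral_ge0 => w _.
have -> : (\int[Q]_w ((g w - c) ^+ 2 * e x w) =
    D x + (- 2 * c * L x + (c ^+ 2 * x ^- k + 0 * x ^- k)))%R.
  rewrite -mass' -Rintegral_lin; [|exact: intg2|exact: intg|exact: inte|exact: inte].
  by apply: eq_Rintegral => w _; ring.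
have -> : c ^+ 2 * x ^- k = x ^+ k * L x ^+ 2 by rewrite /c; field.
have -> : - 2 * c * L x = - 2 * (x ^+ k * L x ^+ 2) by rewrite /c; ring.
lra.
Qed.

(** Differentiation under the integral on the interval from [x / 2] to [x + 1]: as [Y] is
    nonnegative, [e] decreases in the rate, so its value at [x / 2] yields the integrable bound
    [G]. *)
Let derive_L (x : R) : 0 < x -> is_derive x 1 L (- M x).
Proof.
move=> x0; pose f z w := g w * e z w.
have df (z : R) w : is_derive z 1 (f ^~ w) (- (g w * Y w * e z w)).
  rewrite (_ : - _ = g w * (- Y w * expR ((1 - z) * Y w))); last by rewrite /e; ring.
  apply: is_derive_mull.
  have dlin : is_derive z 1 (fun z => (1 - z) * Y w) (- Y w).
    rewrite (_ : (fun _ => _) = (fun t : R => Y w * (1 - t))); last first.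
      by apply/funext => t; rewrite mulrC.
    rewrite (_ : - Y w = Y w * (0 - 1)); last by rewrite sub0r mulrN1.
    apply: is_derive_mull.
  rewrite mulrC; exact: (@is_derive1_comp _ expR _ _ _ _ (is_derive_expR _) dlin).
pose G w := `|g w * Y w * e (x / 2) w|.
have xI : `](x / 2), (x + 1)[%classic x by rewrite /= in_itv/=; lra.
have Ipos z : `](x / 2), (x + 1)[%classic z -> 0 < z by rewrite /= in_itv/=; lra.
have x20 : 0 < x / 2 by rewrite divr_gt0.
have intf z : `](x / 2), (x + 1)[%classic z -> Q.-integrable [set: T] (EFin \o f z).
  by move=> /Ipos; exact: intg.
have dfd z w : `](x / 2), (x + 1)[%classic z -> [set: T] w -> derivable (f ^~ w) z 1.
  by move=> _ _; have [] := df z w.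
have dfE z w : partial1of2 f z w = - (g w * Y w * e z w).
  by rewrite partial1of2E; have [_ ->] := df z w.
have G0 w : 0 <= G w by rewrite normr_ge0.
have intG : Q.-integrable [set: T] (EFin \o G).
  exact: (integrable_abse (intgY x20)).
have Gub z w : `](x / 2), (x + 1)[%classic z -> [set: T] w -> `|partial1of2 f z w| <= G w.
  move=> zI _; rewrite dfE normrN /G !normrM !(ger0_norm (e_ge0 _ _)).
  rewrite ler_wpM2l ?mulr_ge0// ler_expR ler_wpM2r//.
  by move: zI; rewrite /= in_itv/=; lra.
apply: DeriveDef.
  exact: (derivable_under_integral measurableT xI intf dfd G0 intG Gub).
rewrite -derive1E (differentiation_under_integral measurableT xI intf dfd G0 intG Gub).
under eq_Rintegral do rewrite dfE -mulN1r.
by rewrite RintegralZl ?mulN1r//; exact: intgY.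
Qed.

Hypothesis m0 : 0 < m.
Hypothesis b0 : 0 < b.
Hypothesis km : (k.+1)%:R <= m^-1.

(* Karlin's argument: [psi] is [L] multiplied by the integrating factor [u],
   and dominance turns into a Riccati inequality for [psi]. *)
Let L_eq0 (x : R) : 0 < x -> L x = 0.
Proof.
pose s := m^-1; pose beta := b / m; pose c := s - k%:R.
have beta0 : 0 < beta by rewrite divr_gt0.
have c1 : 1 <= c by rewrite /c lerBrDr addrC natr1.
have c0 : 0 < c by exact: lt_le_trans c1.
have s0 : 0 < s by rewrite invr_gt0.
(* [u] is the power [s] of [z] times [expR (- beta * z)]; real powers, here and in [a], are written
   through [ln]. *)
pose u (z : R) := expR (s * ln z - beta * z).
pose psi z := u z * L z.
pose dpsi z := u z * - M z + L z * ((s * z^-1 - beta * 1) * u z).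
pose a z := (2 * m)^-1 * expR (beta * z - c * ln z).
have m20 : 0 < 2 * m by rewrite mulr_gt0.
move=> x0; suff : psi x = 0.
  by move=> /eqP; rewrite mulf_eq0 gt_eqF ?expR_gt0//= => /eqP.
(* The exponent [beta * z - c * ln z] is least at [z = c / beta], with value
   [c - c * ln (c / beta)]: this is the global lower bound of [a]. *)
apply: (@riccati_eq0 _ psi dpsi a ((2 * m)^-1 * expR (c - c * ln (c / beta))) (2 * m)^-1) x0.
- by rewrite mulr_gt0 ?invr_gt0 ?expR_gt0.
- by rewrite invr_gt0.
- move=> z z0.
  have du : is_derive z 1 u ((s * z^-1 - beta * 1) * u z).
    rewrite mulrC; apply: (@is_derive1_comp _ expR (fun t => s * ln t - beta * t)).
    apply: is_deriveB; first by apply: is_derive_mull; exact: is_derive1_ln.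
  exact: (@is_deriveM _ _ u L z 1 _ _ du (derive_L z0)).
- move=> z z0; have uz : 0 < u z by exact: expR_gt0.
  have E : expR (beta * z - c * ln z) * u z = z ^+ k.
    rewrite -expRD (_ : beta * z - c * ln z + (s * ln z - beta * z) = k%:R * ln z); last first.
      by rewrite /c; ring.
    by rewrite expRM_natl lnK.
  have -> : a z * psi z ^+ 2 = (2 * m)^-1 * u z * (z ^+ k * L z ^+ 2).
    by rewrite /a /psi -E; ring.
  (* [s] and [beta] are chosen so that the derivative is a multiple of the cross term controlled by
     [dominance]. *)
  have -> : dpsi z = (2 * m)^-1 * u z * (- 2 * (m * M z + (b - z^-1) * L z)).
    rewrite /dpsi /s /beta; field.
    by rewrite !gt_eqF.
  rewrite ler_wpM2l ?mulr_ge0 ?invr_ge0 ?(ltW m20) ?(ltW uz)//.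
  apply: le_trans (cauchy_schwarz z0) _.
  by have := dominance z0; lra.
- move=> z z0; rewrite ler_wpM2l ?invr_ge0 ?(ltW m20)// ler_expR.
  pose t := beta * z / c.
  have t0 : 0 < t by rewrite divr_gt0// mulr_gt0.
  have lnt : ln t = ln beta + ln z - ln c.
    by rewrite /t lnM ?posrE ?mulr_gt0 ?invr_gt0// lnM ?posrE// lnV ?posrE.
  have H : ln t <= t - 1.
    have := @le_ln1Dx R (t - 1); rewrite addrCA subrr addr0; apply; lra.
  have : c * ln t <= c * (t - 1) by rewrite ler_wpM2l ?(ltW c0).
  have -> : c * (t - 1) = beta * z - c by rewrite /t; field; rewrite gt_eqF.
  have lncb : ln (c / beta) = ln c - ln beta.
    by rewrite lnM ?posrE ?invr_gt0// lnV ?posrE.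
  rewrite lnt lncb; lra.
(* Near 0 the bound rests on [c >= 1], that is, on [km]: the power [- c] of [z] is then at least
   [z^-1], and [expR (beta * z)] is at least 1. *)
- move=> z /andP[z0 z1]; rewrite ler_wpM2l ?invr_ge0 ?(ltW m20)//.
  rewrite -[z in leLHS]lnK ?posrE// -expRN ler_expR.
  have lnz : ln z <= 0 by rewrite ln_le0.
  have bz : 0 <= beta * z by rewrite mulr_ge0 ?ltW.
  have : 0 <= (c - 1) * - ln z by rewrite mulr_ge0 ?subr_ge0 ?oppr_ge0.
  nra.
Qed.

(** Since [L] vanishes on the positive axis, so does its derivative, hence [M 1 = 0]. Dominance at
    1, where the weight [e] is 1, leaves a nonpositive integral of [g ^+ 2]. *)
Lemma karlin_ae_eq0 : {ae Q, forall w, g w = 0}.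
Proof.
have M1 : M 1 = 0.
  have [_ E] := derive_L ltr01; apply/eqP; rewrite -oppr_eq0 -E; apply/eqP.
  rewrite (@near_eq_derive _ _ _ L (cst 0)) ?derive_cst//.
  by near=> t; apply: L_eq0; near: t; exact: lt_nbhsr.
have D1 : D 1 <= 0.
  by have := dominance ltr01; rewrite M1 L_eq0// !mulr0 addr0 mulr0 addr0.
have int0 : (\int[Q]_w `|(g w ^+ 2 * e 1 w)%:E| = 0)%E.
  under eq_integral do rewrite /= ger0_norm ?sqe_ge0//.
  have fin := integrable_fin_num measurableT (intg2 ltr01).
  rewrite -(fineK fin); congr (_%:E); apply/eqP; rewrite eq_le D1/=.
  by apply: Rintegral_ge0.
have mf : measurable_fun [set: T] (fun w => (g w ^+ 2 * e 1 w)%:E).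
  by apply/measurable_EFinP/measurable_funM => //; exact: measurable_funX.
have [/(_ int0) + _] := ae_eq_integral_abs Q measurableT mf.
apply: filterS => w /(_ I) /= [] /eqP.
by rewrite /e subrr mul0r expR0 mulr1 sqrf_eq0 => /eqP.
Unshelve. all: by end_near. Qed.

End karlin.

(** * Risks as integrals under the unit scale *)

Section scale_admissibility.
Context {R : realType} {disp : measure_display} {T : measurableType disp}.
Variables (P : R -> probability T R) (X : nat -> {mfun T >-> R}) (k : nat).
Hypothesis hX : forall delta : R, 0 < delta -> iid_exponential (P delta) X delta.

Let Y (w : T) := record_range (fun i => X i w) k.+1.

Let mY : measurable_fun [set: T] Y.
Proof. exact: measurable_record_range. Qed.

Let Y_ge0 w : 0 <= Y w. Proof. exact: record_range_ge0. Qed.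

Lemma record_range_tilt (phi : R -> \bar R) (delta : R) : 0 < delta ->
  (forall z, 0 <= phi z)%E -> measurable_fun [set: R] phi ->
  (\int[P delta]_w phi (Y w) =
   (delta ^- k)%:E * \int[P 1]_w ((expR ((1 - delta^-1) * Y w))%:E * phi (Y w)))%E.
Proof.
move=> delta0 phi0 mphi.
have [ind law] := hX delta0; have [ind1 law1] := hX ltr01.
have V0 : 0 < delta^-1 by rewrite invr_gt0.
have V1 : 0 < 1^-1 :> R by rewrite invr1.
rewrite (record_range_law V0 ind law)// iter_waiting_mean_tilt//.
rewrite mulr0 expR0 mulr1 exprVn; congr (_ * _)%E.
pose psi z : \bar R := ((expR ((1 - delta^-1) * z))%:E * phi z)%E.
rewrite (record_range_law V1 ind1 law1 k (phi := psi)) ?invr1//.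
- by move=> z; rewrite mule_ge0// lee_fin expR_ge0.
- apply: emeasurable_funM => //; apply/measurable_EFinP.
  by apply: measurableT_comp => //; exact: measurable_funM.
Qed.

(** The change of scale applied to the constant 1 at [delta = x^-1] gives the normalising
    constant. *)
Let tilt_mass x : 0 < x -> (\int[P 1]_w (expR ((1 - x) * Y w))%:E = (x ^- k)%:E)%E.
Proof.
move=> x0; have xV0 : 0 < x^-1 by rewrite invr_gt0.
have mass1 : (\int[P x^-1]_w cst 1 (Y w) = 1)%E.
  transitivity (1 * P x^-1 setT)%E; first exact: integral_cst.
  by rewrite mul1e; exact: probability_setT.
have := @record_range_tilt (cst 1%E) x^-1 xV0 (fun=> lee01) (measurable_cst _).
rewrite mass1 exprVn !invrK.
under eq_integral do rewrite mule1.
move=> E.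
have xk0 : x ^+ k != 0 by rewrite expf_neq0// gt_eqF.
set I := (\int[P 1]_w (expR ((1 - x) * Y w))%:E)%E in E *.
transitivity ((x ^- k * x ^+ k)%:E * I)%E; first by rewrite mulVf// mul1e.
by rewrite EFinM -muleA -E mule1.
Qed.

Let riskE (est : R -> R) (delta : R) : 0 < delta -> measurable_fun [set: R] est ->
  risk P squared_error Y est delta =
  ((delta ^- k)%:E * \int[P 1]_w
     ((est (Y w) - delta) ^+ 2 * expR ((1 - delta^-1) * Y w))%:E)%E.
Proof.
move=> delta0 mest; rewrite /risk /squared_error unlock.
rewrite (@record_range_tilt (fun r => ((est r - delta) ^+ 2)%:E))//.
- by congr (_ * _)%E; apply: eq_integral => w _; rewrite -EFinM mulrC.
- by move=> r; rewrite lee_fin sqr_ge0.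
- by apply/measurable_EFinP/measurable_funX; exact: measurable_funB.
Qed.

Let mintegrand (est : R -> R) (delta : R) : measurable_fun [set: R] est ->
  measurable_fun [set: T]
    (fun w => ((est (Y w) - delta) ^+ 2 * expR ((1 - delta^-1) * Y w))%:E).
Proof.
move=> mest; apply/measurable_EFinP/measurable_funM.
  by apply: measurable_funX; apply: measurable_funB => //; exact: measurableT_comp.
by apply: measurableT_comp => //; exact: measurable_funM.
Qed.

Let integrand_ge0 (est : R -> R) (delta : R) w :
  0 <= (est (Y w) - delta) ^+ 2 * expR ((1 - delta^-1) * Y w).
Proof. by rewrite mulr_ge0 ?sqr_ge0 ?expR_ge0. Qed.

(** Every risk is an integral under [P 1], so one null set serves all scales. *)
Let risk_ae (est est' : R -> R) (delta : R) : 0 < delta ->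
  measurable_fun [set: R] est -> measurable_fun [set: R] est' ->
  {ae P 1, forall w, est' (Y w) = est (Y w)} ->
  risk P squared_error Y est' delta = risk P squared_error Y est delta.
Proof.
move=> delta0 mest mest' ae_est; rewrite !riskE//; congr (_ * _)%E.
apply: ge0_ae_eq_integral => //; try exact: mintegrand.
- by move=> w _; rewrite lee_fin integrand_ge0.
- by move=> w _; rewrite lee_fin integrand_ge0.
- by apply: filterS ae_est => w -> _.
Qed.

Let admissible_ae (est : R -> R) : measurable_fun [set: R] est ->
  (forall est' : R -> R, measurable_fun [set: R] est' ->
     (forall delta : R, 0 < delta ->
       (risk P squared_error Y est' delta <= risk P squared_error Y est delta)%E) ->
     {ae P 1, forall w, est' (Y w) = est (Y w)}) ->
  admissible P squared_error Y est.
Proof.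
move=> mest H; split=> // -[est' [mest' le_risk [delta delta0]]].
by rewrite (risk_ae delta0 mest mest' (H _ mest' le_risk)) ltxx.
Qed.

(** * Admissibility *)

(** The risk at [delta = c] is zero, so a competitor has zero squared error there; positivity of the
    tilt makes it equal to [c] almost surely. *)
Lemma admissible_constant (c : R) : 0 < c -> admissible P squared_error Y (cst c).
Proof.
move=> c0; apply: admissible_ae => // est' mest' /(_ c c0).
rewrite !riskE// [X in (_ <= _ * X)%E](_ : _ = 0%E); last first.
  by apply: integral0_eq => w _; rewrite subrr expr0n mul0r.
have ck0 : 0 < c ^- k by rewrite invr_gt0 exprn_gt0.
rewrite lee_pmul2l// => le0.
have int0 : (\int[P 1]_w `|((est' (Y w) - c) ^+ 2 * expR ((1 - c^-1) * Y w))%:E| = 0)%E.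
  under eq_integral do rewrite /= ger0_norm ?integrand_ge0//.
  apply/eqP; rewrite eq_le le0/=; apply: integral_ge0 => w _.
  by rewrite lee_fin integrand_ge0.
have [/(_ int0) + _] := ae_eq_integral_abs (P 1) measurableT (mintegrand c mest').
apply: filterS => w /(_ I) /= [] /eqP.
by rewrite mulf_eq0 sqrf_eq0 (gt_eqF (expR_gt0 _)) orbF subr_eq0 => /eqP.
Qed.

Lemma admissible_affine (m b : R) : 0 < m -> 0 < b -> m <= (k.+1)%:R^-1 ->
  admissible P squared_error Y (fun r => m * r + b).
Proof.
move=> m0 b0 km; have mest : measurable_fun [set: R] (fun r : R => m * r + b).
  by apply: measurable_funD => //; exact: measurable_funM.
apply: admissible_ae => // est' mest' le_risk.
pose g w := est' (Y w) - (m * Y w + b).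
have mg : measurable_fun [set: T] g.
  apply: measurable_funB; first exact: measurableT_comp.
  by apply: measurable_funD => //; exact: measurable_funM.
have dom x : 0 < x ->
    (\int[P 1]_w ((g w + (m * Y w + b - x^-1)) ^+ 2 * expR ((1 - x) * Y w))%:E <=
     \int[P 1]_w ((m * Y w + b - x^-1) ^+ 2 * expR ((1 - x) * Y w))%:E)%E.
  move=> x0; have xV0 : 0 < x^-1 by rewrite invr_gt0.
  (* The common positive factor of the two risks at [delta = x^-1] cancels, leaving the tilted
     integrals that Karlin's argument compares. *)
  have := le_risk _ xV0; rewrite !riskE// lee_pmul2l//; last first.
    by rewrite lte_fin invr_gt0 exprn_gt0.
  rewrite invrK => le; apply: le_trans le; rewrite le_eqVlt; apply/orP; left.
  by apply/eqP/eq_integral => w _; rewrite /g addrA subrK.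
have km' : (k.+1)%:R <= m^-1 by rewrite -[leLHS]invrK lef_pV2 ?posrE ?invr_gt0 ?ltr0n.
have := karlin_ae_eq0 mY Y_ge0 tilt_mass mg dom m0 b0 km'.
by apply: filterS => w /eqP; rewrite /g subr_eq0 => /eqP.
Qed.

End scale_admissibility.

Unset Implicit Arguments.

Theorem mainTheorem2 (R : realType) (disp : measure_display)
  (T : measurableType disp) (P : R -> probability T R)
  (X : nat -> {mfun T >-> R}) (n : nat) (m d : R)
  (hn : (2 <= n)%N)
  (hX : forall delta : R, 0 < delta -> iid_exponential (P delta) X delta) :
  let Rn := fun w : T => record_range (fun i => X i w) n in
  let est := fun r : R => m * r + d in
  (0 <= m < n%:R^-1 -> 0 < d -> admissible P squared_error Rn est) /\
  (m = n%:R^-1 -> 0 < d -> admissible P squared_error Rn est).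
Proof.
case: n hn => [//|k] _ Rn est; split=> [/andP[m0 /ltW km] d0|m_eq d0]; last first.
  by apply: admissible_affine; rewrite // m_eq ?lexx// invr_gt0 ltr0n.
(* The integrating factor has exponent [m^-1], so [m = 0] is treated as a constant estimator. *)
have [m_eq0|m_neq0] := eqVneq m 0; last first.
  by apply: admissible_affine => //; rewrite lt_neqAle eq_sym m_neq0.
rewrite (_ : est = cst d); first exact: admissible_constant.
by apply/funext => r; rewrite /est m_eq0 mul0r add0r.
Qed.
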